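(* Let $K\ge2$ and let $\varphi^{(1)},\dots,\varphi^{(K)}\in\mathbb{R}^n$ be unit vectors with $\rho_{ij}=\langle\varphi^{(i)},\varphi^{(j)}\rangle$, $|\rho_{ij}|<1$ for $i\ne j$, and let $\sigma_1,\dots,\sigma_K>0$. Let $\xi\sim\mathcal{N}_n(0,I_n)$, $X_i=\sigma_i\langle\varphi^{(i)},\xi\rangle$, $Y_i=\sigma_i\langle\varphi^{(i)},\xi/\Vert\xi\Vert\rangle$, $X_{\max}=\max_{1\le i\le K}X_i$, $Y_{\max}=\max_{1\le i\le K}Y_i$. Define \[ b_{\mathrm{cri}}^2=\max_{i\ne j}\frac{\sigma_i^2}{1+h(i,j)},\qquad h(i,j)=\frac{(\sigma_i/\sigma_j-\rho_{ij})_+^2}{1-\rho_{ij}^2},\qquad b_{\mathrm{cri}}\ge0. \] Then \[ \mathbb{P}(Y_{\max}>b)=\sum_{i=1}^K\frac12\,\bar B_{\frac12,\frac12(n-1)}(b^2/\sigma_i^2)\qquad\text{for all } b\ge b_{\mathrm{cri}}, \] and \[ \mathbb{P}(X_{\max}>c)=\sum_{i=1}^K\bar\Phi(c/\sigma_i)+O\bigl(\bar G_n(c^2/b_{\mathrm{cri}}^2)\bigr),\qquad c\to\infty. \] Both formulas hold even if the summation $\sum_{i=1}^K$ is replaced with $\sum_{i:\sigma_i>b_{\mathrm{cri}}}$.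
   Context: $x_+=\max\{x,0\}$. $\bar B_{a,b}(x)=\frac{\Gamma(a+b)}{\Gamma(a)\Gamma(b)}\int_x^1t^{a-1}(1-t)^{b-1}\mathrm{d}t$ for $0\le x\le1$ and $\bar B_{a,b}(x)=0$ for $x>1$. $\bar\Phi(x)=(2\pi)^{-1/2}\int_x^\infty e^{-t^2/2}\mathrm{d}t$. $\bar G_\nu(x)=\frac{1}{2^{\nu/2}\Gamma(\nu/2)}\int_x^\infty t^{\nu/2-1}e^{-t/2}\mathrm{d}t$ is the upper probability of the chi-square distribution with $\nu$ degrees of freedom. Thus $(X_1,\dots,X_K)$ is a centered Gaussian vector with $\mathrm{Var}(X_i)=\sigma_i^2$ and $\mathrm{Corr}(X_i,X_j)=\rho_{ij}$. *)

(* Defs.v *)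
From HB Require Import structures.
From mathcomp Require Export all_boot all_order all_algebra.
From mathcomp Require Export all_classical all_reals all_analysis.

Set Implicit Arguments.
Unset Strict Implicit.
Unset Printing Implicit Defensive.

Import Order.TTheory GRing.Theory Num.Theory.
Import numFieldNormedType.Exports.

Local Open Scope classical_set_scope.
Local Open Scope ring_scope.

(* Lets the Landau notations be used at +oo. *)
Canonical pinfty_filter_on (R : realType) : filter_on R :=
  FilterType (pinfty_nbhs R) _.

Section special_functions.
Context {R : realType}.
Implicit Types a b x nu : R.
Local Notation mu := (@lebesgue_measure R).

Definition Gamma a : R :=
  (\int[mu]_(t in `]0, +oo[) (t `^ (a - 1) * expR (- t)))%R.

Definition Bbar a b x : R :=
  if x <= 1 then
    Gamma (a + b) / (Gamma a * Gamma b) *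
    (\int[mu]_(t in `[x, 1]) (t `^ (a - 1) * (1 - t) `^ (b - 1)))%R
  else 0.

Definition Phibar x : R :=
  (2 * pi) `^ (- (1 / 2)) *
  (\int[mu]_(t in `[x, +oo[) expR (- (t ^+ 2 / 2)))%R.

Definition Gbar nu x : R :=
  (2 `^ (nu / 2) * Gamma (nu / 2))^-1 *
  (\int[mu]_(t in `[x, +oo[) (t `^ (nu / 2 - 1) * expR (- t / 2)))%R.

End special_functions.

Section euclidean.
Context {R : realType} {n : nat}.
Implicit Types u v : 'rV[R]_n.

Definition dot u v : R := \sum_(k < n) u 0 k * v 0 k.

(* The norm `|u| of the library on 'rV[R]_n is the sup norm. *)
Definition enorm u : R := Num.sqrt (dot u u).

End euclidean.

(* The base value of the iterated maximum is one of the values of F, so this is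
   the maximum of F whatever the signs of the F i. *)
Definition maxI {R : realType} {K : nat} (hK : (0 < K)%N) (F : 'I_K -> R) : R :=
  \big[Num.max/F (Ordinal hK)]_(i < K) F i.

Section gaussian.
Context {R : realType} {d : measure_display} {Omega : measurableType d}.
Variable P : probability Omega R.

Definition mutually_independent {n : nat} (Z : 'I_n -> {RV P >-> R}) : Prop :=
  forall (J : {set 'I_n}) (A : 'I_n -> set R), (forall k, measurable (A k)) ->
    P [set w | forall k, k \in J -> A k (Z k w)]
    = (\prod_(k in J) P (Z k @^-1` A k))%E.

(* The random vector with components Z k has the law N_n(0, I_n). *)
Definition std_gaussian {n : nat} (Z : 'I_n -> {RV P >-> R}) : Prop :=
  (forall k (A : set R), measurable A ->
     distribution P (Z k) A = normal_prob 0 1 A)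
  /\ mutually_independent Z.

Definition vec {n : nat} (Z : 'I_n -> {RV P >-> R}) (w : Omega) : 'rV[R]_n :=
  \row_k Z k w.

End gaussian.

Section maxima.
Context {R : realType} {K n : nat}.
Variables (sigma : 'I_K -> R) (phi : 'I_K -> 'rV[R]_n).

Definition rho (i j : 'I_K) : R := dot (phi i) (phi j).

Definition h (i j : 'I_K) : R :=
  Num.max (sigma i / sigma j - rho i j) 0 ^+ 2 / (1 - rho i j ^+ 2).

(* The nonnegative square root of the maximum. The values are nonnegative when
   |rho i j| < 1 for i != j, so the base value 0 does not affect their maximum
   as soon as K >= 2. *)
Definition b_cri : R :=
  Num.sqrt (\big[Num.max/0]_(p : 'I_K * 'I_K | p.1 != p.2)
              (sigma p.1 ^+ 2 / (1 + h p.1 p.2))).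

(* The values X_i and Y_i at a point x of the sample space R^n. For Y_i the
   value at x = 0, here 0, concerns a null event only. *)
Definition Xval (x : 'rV[R]_n) (i : 'I_K) : R := sigma i * dot (phi i) x.

Definition Yval (x : 'rV[R]_n) (i : 'I_K) : R :=
  sigma i * dot (phi i) ((enorm x)^-1 *: x).

Definition Xmax (hK : (0 < K)%N) (x : 'rV[R]_n) : R := maxI hK (Xval x).

Definition Ymax (hK : (0 < K)%N) (x : 'rV[R]_n) : R := maxI hK (Yval x).

End maxima.

(* Main.v *)
Require Import Defs.
From mathcomp Require Import measurable_realfun.
From mathcomp Require Import ring lra.
Import Order.TTheory GRing.Theory Num.Theory.
Import numFieldNormedType.Exports.
Local Open Scope classical_set_scope.
Local Open Scope ring_scope.

(** Why the theorem holds. If two distinct forms [X_i] and [X_j] both exceed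
    c >= 0 at a point x, the Gram determinant of phi_i, phi_j and x bounds |x|
    from below, and [b_cri] is defined so that the bound reads
    c ^ 2 < b_cri ^ 2 |x| ^ 2 ([b_cri_norm_lt]). If sigma_i <= b_cri, the same
    bound follows from X_i > c alone, by the Cauchy-Schwarz inequality.
    Normalising by the norm, for b >= b_cri the events Y_i > b are pairwise
    disjoint, and empty when sigma_i <= b_cri; so the probability of their
    union is the sum. For the unnormalised forms the events X_i > c have these
    properties outside the event |xi| ^ 2 > c ^ 2 / b_cri ^ 2, whose probability
    is the upper chi-square tail, and the error is at most K + 1 times this tail
    ([union_approx]).

    What remains is to compute three tails: of <a, xi> for a unit vector a
    ([prefix_dot_tail]), of |xi| ^ 2 ([prefix_sqnorm_tail]), and of the ratio of
    <a, xi> to |xi| ([ratio_tail]). All three follow from the joint law of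
    <a, xi> and |xi| ^ 2, which is that of W and W ^ 2 + T, with W Gaussian and
    T an independent squared norm in one dimension less ([joint_law]). It is
    built one coordinate at a time: a new coordinate is merged into W by a
    rotation of the plane, which the product of two Gaussian measures does not
    see ([normal_rotation]). The squared norm has a gamma law because
    gamma laws are stable under convolution ([prefix_sqnorm_law]). The
    convolution and the beta tail of the ratio come out of the same change of
    variables, (p, q) |-> (p / (p + q), p + q) ([beta_gamma]).

    The integrals are transformed by affine substitutions and Tonelli's theorem
    only. The one substitution of another kind, t = x ^ 2, is obtained up to a
    constant from the uniqueness of the scale-invariant measure dx / x
    ([ge0_integral_haar_sqr]). Such constants are carried along without being
    evaluated: probability measures have mass 1, and this both determines them
    and shows that the values of [Gamma] that occur are finite and positive. *)

(** * Lebesgue measure under affine maps *)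

(** Lebesgue measure lives on [measurableTypeR R], a copy of [R] that canonical
    structures do not identify with [R]; bundling a pushforward on that copy
    lets it be compared with Lebesgue measure. *)
Definition image_measure d (T : measurableType d) (R : realType)
    (m : {measure set T -> \bar R}) (f : T -> R)
    (mf : measurable_fun setT f) :
    {measure set (measurableTypeR R) -> \bar R} :=
  measure_function_pushforward__canonical__measure_function_Measure
    (T2 := measurableTypeR R) m mf.

Section substitutions.
Context {R : realType}.
Local Notation mu := (@lebesgue_measure R).
Local Open Scope ereal_scope.

Lemma measurable_affine (a b : R) :
  measurable_fun setT (fun x : R => (a * x + b)%R).
Proof. by apply: measurable_funD => //; apply: measurable_funM. Qed.

(** By uniqueness of Lebesgue measure it is enough to look at half-open
    intervals once [a] is positive; negative [a] adds a reflection. *)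
Lemma lebesgue_measure_affine (a b : R) (A : set R) : (a != 0)%R ->
  measurable A ->
  `|a|%:E * mu ((fun x : R => a * x + b)%R @^-1` A) = mu A.
Proof.
wlog a0 : a / (0 < a)%R => [wlog_pos|_].
  case: (ltgtP a 0%R) => // a0 _ mA; last by rewrite wlog_pos// gt_eqF.
  rewrite -normrN -(wlog_pos (- a)%R)// ?oppr_gt0// ?gt_eqF ?oppr_gt0//.
  congr (_ * _); rewrite -[in RHS]lebesgue_measureN; last first.
    by rewrite -[_ @^-1` _]setTI; exact: measurable_affine.
  by congr (mu _); apply/seteqP; split => x /=; rewrite mulrNN.
move=> mA; rewrite gtr0_norm//.
pose m' : {measure set (measurableTypeR R) -> \bar R} :=
  mscale (NngNum (ltW a0))
  (image_measure _ _ _ mu _ (measurable_affine a b)).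
suff : mu A = m' A by move=> ->.
refine (@lebesgue_measure_unique R m' _ A mA) => _ [[u v] /= uv <-].
rewrite /m' /mscale/= /pushforward/= .
have -> : (fun x : R => a * x + b)%R @^-1` `]u, v] =
    `]((u - b) / a)%R, ((v - b) / a)%R]%classic :> set R.
  by apply/seteqP; split => x /=; rewrite !in_itv/= ltr_pdivrMr//
    ler_pdivlMr// (mulrC x) ltrBlDr lerBrDr.
rewrite !lebesgue_measure_itv/= !lte_fin ltr_pM2r ?invr_gt0// ltrD2r.
case: ifPn => _; rewrite ?mule0// -!EFinB -EFinM; congr EFin; field.
by rewrite gt_eqF.
Qed.

Lemma ge0_integral_affine (a b : R) (f : R -> \bar R) : (a != 0)%R ->
  measurable_fun setT f -> (forall x, 0 <= f x) ->
  `|a|%:E * \int[mu]_x f (a * x + b)%R = \int[mu]_x f x.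
Proof.
move=> a0 mf f0.
pose m1 := image_measure _ _ _ mu _ (measurable_affine a b).
have am : (0 <= `|a|^-1)%R by [].
pose m2 : {measure set (measurableTypeR R) -> \bar R} := mscale (NngNum am) mu.
transitivity (`|a|%:E * \int[m1]_x f x).
  by rewrite ge0_integral_pushforward//; exact: measurable_affine.
transitivity (`|a|%:E * \int[m2]_x f x).
  congr (_ * _); apply: eq_measure_integral => A mA _.
  rewrite /m2/= /mscale/= -(lebesgue_measure_affine _ b _ a0 mA).
  by rewrite muleA -EFinM mulVf ?mul1e// normr_eq0.
by rewrite ge0_integral_mscale//= muleA -EFinM divff ?mul1e// normr_eq0.
Qed.

End substitutions.

(** * Half-line powers, gamma weights and measurability *)

Section half_line.
Context {R : realType}.

(** Cutting powers off at 0 turns every integral over a half-line into one over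
    the line, where Tonelli's theorem applies. Two exponents have another role:
    [half_pow 1] is the indicator of the positive half-line, and [half_pow 0]
    is the density of dx / x, the measure invariant under scaling. *)
Definition half_pow (a x : R) : R := (if 0 < x then x `^ (a - 1) else 0)%R.

Lemma half_pow_ge0 a x : (0 <= half_pow a x)%R.
Proof. by rewrite /half_pow; case: ifPn => // _; exact: powR_ge0. Qed.

Lemma measurable_half_pow a : measurable_fun setT (half_pow a).
Proof.
apply: measurable_fun_ifT => //; exact: measurable_fun_ltr.
Qed.

(** The gamma density with shape [a] and scale 2, without its normalising
    constant; for [a = n / 2] this is chi-square with [n] degrees of freedom. *)
Definition gamma_wt (a x : R) : R := half_pow a x * expR (- x / 2).

Lemma gamma_wt_ge0 a x : 0 <= gamma_wt a x.
Proof. by rewrite mulr_ge0 ?half_pow_ge0 ?expR_ge0. Qed.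

Lemma measurable_gamma_wt a : measurable_fun setT (gamma_wt a).
Proof.
apply: measurable_funM; first exact: measurable_half_pow.
apply: (measurableT_comp (@measurable_expR _)).
by apply: measurable_funM => //; exact: measurable_funN.
Qed.

End half_line.

Lemma measurable_fun2 d d1 d2 d3 (T : measurableType d) (T1 : measurableType d1)
    (T2 : measurableType d2) (T3 : measurableType d3)
    (F : T1 -> T2 -> T3) (u : T -> T1) (v : T -> T2) :
  measurable_fun setT (fun z : T1 * T2 => F z.1 z.2) ->
  measurable_fun setT u -> measurable_fun setT v ->
  measurable_fun setT (fun x => F (u x) (v x)).
Proof.
move=> mF mu mv; apply: (measurableT_comp mF (g := fun x => (u x, v x))).
exact: measurable_fun_pair.
Qed.

Lemma measurable_fun_ltb d (T : measurableType d) (R : realType)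
    (u v : T -> R) :
  measurable_fun setT u -> measurable_fun setT v ->
  measurable_fun setT (fun x => (u x < v x)%R%:R : R).
Proof.
move=> mu mv; rewrite (_ : (fun x => _) =
  (fun x => if u x < v x then 1 else 0)); last first.
  by apply/funext => x; case: (u x < v x)%R.
by apply: measurable_fun_ifT => //; exact: measurable_fun_ltr.
Qed.

Lemma measurable_lt_set d (T : measurableType d) (R : realType) (u v : T -> R) :
  measurable_fun setT u -> measurable_fun setT v ->
  measurable [set x | u x < v x].
Proof.
move=> mu mv; have := measurable_fun_ltr mu mv.
by move=> /(_ measurableT [set true]); rewrite setTI; apply.
Qed.

(** Syntax-directed measurability of the integrands below: arithmetic,
    exponentials, half-line powers, comparisons, and functions of one or two
    variables that the context knows to be measurable. *)
Ltac solve_measurable := repeat first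
  [ assumption
  | exact: measurable_cst | exact: measurable_id | exact: measurable_fst
  | exact: measurable_snd | exact: measurable_half_pow
  | exact: measurable_gamma_wt | exact: measurable_powR | exact: measurable_expR
  | match goal with
    | |- measurable_fun _ (fun x => (@?f x * @?g x)%R) => apply: measurable_funM
    | |- measurable_fun _ (fun x => (@?f x + @?g x)%R) => apply: measurable_funD
    | |- measurable_fun _ (fun x => (nat_of_bool (@?u x < @?v x)%R)%:R) =>
        apply: measurable_fun_ltb
    | |- measurable_fun _ (fun x => fst (@?u x)) =>
        apply: (measurableT_comp (@measurable_fst _ _ _ _))
    | |- measurable_fun _ (fun x => snd (@?u x)) =>
        apply: (measurableT_comp (@measurable_snd _ _ _ _))
    | |- measurable_fun _ (+%R ?q) =>
        apply: (@measurable_funD _ _ _ _ (fun=> q) id)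
    | |- measurable_fun _ ( *%R ?q) =>
        apply: (@measurable_funM _ _ _ _ (fun=> q) id)
    | |- measurable_fun _ (fun x => (- @?f x)%R) => apply: measurable_funN
    | |- measurable_fun _ (fun x => (@?f x ^+ _)%R) => apply: measurable_funX
    | |- measurable_fun _ (fun x => (@?f x * @?g x)%E) =>
      apply: emeasurable_funM
    | |- measurable_fun _ (fun x => (@?f x)%:E) => apply/measurable_EFinP
    | |- measurable_fun _ (fun x => (@?f x, @?g x)) =>
      apply: measurable_fun_pair
    | |- measurable_fun _ (fun x => expR (@?g x)) =>
        apply: (measurableT_comp (@measurable_expR _))
    | |- measurable_fun _ (fun x => half_pow ?a (@?g x)) =>
        apply: (measurableT_comp (@measurable_half_pow _ a))
    | |- measurable_fun _ (fun x => powR (@?g x) ?a) =>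
        apply: (measurableT_comp (@measurable_powR _ a))
    | |- measurable_fun _ (fun x => gamma_wt ?a (@?g x)) =>
        apply: (measurableT_comp (@measurable_gamma_wt _ a))
    | H : measurable_fun setT ?f |- measurable_fun _ (fun x => ?f (@?g x)) =>
        apply: (measurableT_comp H)
    | H : measurable_fun setT (fun z => ?F z.1 z.2)
      |- measurable_fun _ (fun x => ?F (@?u x) (@?v x)) =>
        apply: (measurable_fun2 _ _ _ _ _ _ _ _ F u v H)
    | H : measurable_fun setT (fun z => ?F z.1 z.2)
      |- measurable_fun _ (?F ?x) =>
        exact: (measurableT_comp H (pair1_measurable x))
    end ].

(** * Squaring the variable, by uniqueness of Haar measure *)

Lemma ge0_integral_swap d1 d2 (T1 : measurableType d1) (T2 : measurableType d2)
    (R : realType) (m1 : {sigma_finite_measure set T1 -> \bar R})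
    (m2 : {sigma_finite_measure set T2 -> \bar R}) (F : T1 -> T2 -> \bar R) :
  measurable_fun setT (fun z : T1 * T2 => F z.1 z.2) ->
  (forall x y, 0 <= F x y)%E ->
  (\int[m1]_x \int[m2]_y F x y = \int[m2]_y \int[m1]_x F x y)%E.
Proof.
move=> mF F0; exact: (fubini_tonelli (fun z : T1 * T2 => F z.1 z.2)).
Qed.

Lemma measurable_fun_integral d1 d2 (T1 : measurableType d1)
    (T2 : measurableType d2) (R : realType)
    (m2 : {sigma_finite_measure set T2 -> \bar R}) (F : T1 -> T2 -> \bar R) :
  measurable_fun setT (fun z : T1 * T2 => F z.1 z.2) ->
  (forall x y, 0 <= F x y)%E ->
  measurable_fun setT (fun x => \int[m2]_y F x y)%E.
Proof.
move=> mF F0.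
exact: (measurable_fun_fubini_tonelli_F (fun z : T1 * T2 => F z.1 z.2)).
Qed.

Section haar.
Context {R : realType}.
Local Notation mu := (@lebesgue_measure R).
Local Open Scope ereal_scope.

(** The form of [ge0_integral_swap] at type [R], which rewriting can unify with
    iterated Lebesgue integrals. *)
Lemma lebesgue_swap (F : R -> R -> \bar R) :
  measurable_fun setT (fun z : R * R => F z.1 z.2) ->
  (forall x y, 0 <= F x y) ->
  \int[mu]_x \int[mu]_y F x y = \int[mu]_y \int[mu]_x F x y.
Proof.
by move=> mF F0; exact: (@ge0_integral_swap _ _ _ _ _ mu mu F mF F0).
Qed.

Lemma ge0_integral_haar_scale (c : R) (f : R -> \bar R) : (0 < c)%R ->
  measurable_fun setT f -> (forall x, 0 <= f x) ->
  \int[mu]_x (f (c * x)%R * (half_pow 0 x)%:E) =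
  \int[mu]_x (f x * (half_pow 0 x)%:E).
Proof.
move=> c0 mf f0; rewrite -[RHS](ge0_integral_affine c 0) ?gt_eqF//;
  last 2 first.
- by solve_measurable.
- by move=> x; rewrite mule_ge0// lee_fin half_pow_ge0.
rewrite gtr0_norm// -ge0_integralZl//; last 3 first.
- by solve_measurable.
- by move=> x _; rewrite mule_ge0// lee_fin half_pow_ge0.
- by rewrite lee_fin ltW.
apply: eq_integral => x _; rewrite addr0 muleCA; congr (_ * _).
rewrite -EFinM; congr EFin; rewrite /half_pow pmulr_rgt0//; case: ifPn => x0;
  last by rewrite mulr0.
by rewrite sub0r !powR_inv1 ?ltW ?mulr_gt0// invfM mulrA divff ?mul1r// gt_eqF.
Qed.

(** Both f |-> \int f (x ^ 2) dx / x and f |-> \int f (t) dt / t are invariant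
    under scaling of [f], hence proportional; this is the proof that invariant
    measures on the multiplicative group are unique, with [h] as test
    function. It replaces the substitution t = x ^ 2 and needs nothing beyond
    linear substitutions and Tonelli's theorem. The constant stays implicit in
    the two integrals of [h]. *)
Lemma ge0_integral_haar_sqr (f h : R -> \bar R) :
  measurable_fun setT f -> (forall x, 0 <= f x) ->
  measurable_fun setT h -> (forall x, 0 <= h x) ->
  (\int[mu]_x (f (x ^+ 2)%R * (half_pow 0 x)%:E)) *
  (\int[mu]_t (h t * (half_pow 0 t)%:E)) =
  (\int[mu]_x (h (x `^ (- 2))%R * (half_pow 0 x)%:E)) *
  \int[mu]_t (f t * (half_pow 0 t)%:E).
Proof.
move=> mf f0 mh h0.
have hw0 x : 0 <= (half_pow 0 x)%:E :> \bar R by rewrite lee_fin half_pow_ge0.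
rewrite -ge0_integralZl//; last 3 first.
- by solve_measurable.
- by move=> x _; rewrite mule_ge0.
- by apply: integral_ge0 => x _; rewrite mule_ge0.
transitivity (\int[mu]_t \int[mu]_x
    (f (t * x ^+ 2)%R * h t * (half_pow 0 t)%:E * (half_pow 0 x)%:E)).
  apply: eq_integral => t _.
  have [t0|t0] := ltP 0%R t; last first.
    rewrite /half_pow ltNge t0/= mule0 mule0 integral0_eq// => x _.
    by rewrite mule0 mul0e.
  (* the scaling x |-> sqrt t * x brings t inside f *)
  rewrite -(ge0_integral_haar_scale (Num.sqrt t) (fun x =>
    f (x ^+ 2)%R)) ?sqrtr_gt0//; last by solve_measurable.
  rewrite muleC -ge0_integralZl//; last 3 first.
  - by solve_measurable.
  - by move=> x _; rewrite mule_ge0.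
  - by rewrite mule_ge0.
  apply: eq_integral => x _; rewrite exprMn sqr_sqrtr ?ltW//.
  by rewrite muleA; congr (_ * _); rewrite muleC muleA.
etransitivity.
  refine (lebesgue_swap (fun t x => f (t * x ^+ 2)%R * h t *
    (half_pow 0 t)%:E * (half_pow 0 x)%:E) _ _); first by solve_measurable.
  by move=> t x; rewrite !mule_ge0.
transitivity (\int[mu]_x \int[mu]_t
    (f t * h (t * x `^ (- 2))%R * (half_pow 0 t)%:E * (half_pow 0 x)%:E)).
  apply: eq_integral => x _.
  have [x0|x0] := ltP 0%R x; last first.
    rewrite /half_pow ltNge x0/= integral0_eq// ?integral0_eq// => t _;
    by rewrite mule0.
  rewrite !ge0_integralZr//; last 4 first.
  - by solve_measurable.
  - by move=> t _; rewrite !mule_ge0.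
  - by solve_measurable.
  - by move=> t _; rewrite !mule_ge0.
  congr (_ * _).
  (* t |-> x ^ 2 * t, which moves the dependence on x from f to h *)
  rewrite -(ge0_integral_haar_scale (x ^+ 2) (fun t =>
    f t * h (t * x `^ (- 2))%R)) ?exprn_gt0//; last 2 first.
  - by solve_measurable.
  - by move=> t; rewrite mule_ge0.
  apply: eq_integral => t _; congr (_ * _); congr (f _ * h _);
    first by rewrite mulrC.
  rewrite powRN -powR_mulrn ?ltW// mulrAC divff ?mul1r//.
  by rewrite gt_eqF// powR_gt0.
etransitivity.
  refine (lebesgue_swap (fun x t => f t * h (t * x `^ (- 2))%R *
    (half_pow 0 t)%:E * (half_pow 0 x)%:E) _ _); first by solve_measurable.
  by move=> x t; rewrite !mule_ge0.
rewrite -ge0_integralZl//; last 3 first.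
- by solve_measurable.
- by move=> t _; rewrite mule_ge0.
- by apply: integral_ge0 => t _; rewrite mule_ge0.
apply: eq_integral => t _.
have [t0|t0] := ltP 0%R t; last first.
  rewrite /half_pow ltNge t0/= mule0 mule0 integral0_eq// => x _.
  by rewrite mule0 mul0e.
have st0 : (0 < t `^ (- 2^-1))%R by rewrite powR_gt0.
(* x |-> t ^ (- 1 / 2) * x, after which the inner integral is free of t *)
rewrite -(ge0_integral_haar_scale (t `^ (- 2^-1))%R (fun x =>
  h (x `^ (-2))%R))//; last by solve_measurable.
rewrite muleC -ge0_integralZl//; last 3 first.
- by solve_measurable.
- by move=> x _; rewrite mule_ge0.
- by rewrite mule_ge0.
apply: eq_integral => x _.
have [x0|x0] := ltP 0%R x; last by rewrite /half_pow (ltNge _ x) x0/= !mule0.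
rewrite powRM ?ltW// -powRrM mulNr mulrN opprK mulVf// powRr1 ?ltW//.
by rewrite muleA; congr (_ * _); rewrite -!muleA; congr (_ * _); rewrite muleC.
Qed.

End haar.

(** * The beta-gamma change of variables *)

Section beta_gamma.
Context {R : realType}.
Local Notation mu := (@lebesgue_measure R).
Local Open Scope ereal_scope.

Lemma ge0_integral_scale (s : R) (K : R -> \bar R) : (0 < s)%R ->
  measurable_fun setT K -> (forall x, 0 <= K x) ->
  \int[mu]_p K p = \int[mu]_t (s%:E * K (s * t)%R).
Proof.
move=> s0 mK K0; rewrite -(ge0_integral_affine s 0) ?gt_eqF//.
rewrite gtr0_norm// -ge0_integralZl//; last 2 first.
- by apply: (measurableT_comp mK); solve_measurable.
- by rewrite lee_fin ltW.
by apply: eq_integral => t _; rewrite addr0.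
Qed.

Lemma ge0_integral_shift (p : R) (K : R -> \bar R) :
  measurable_fun setT K -> (forall x, 0 <= K x) ->
  \int[mu]_q K q = \int[mu]_s K (s - p)%R.
Proof.
move=> mK K0; rewrite -(ge0_integral_affine 1 (- p)) ?oner_eq0//.
by rewrite normr1 mul1e; apply: eq_integral => s _; rewrite mul1r.
Qed.

(** The Jacobian identity behind [beta_gamma]: at (s t, s - s t) the product of
    two gamma weights splits into a beta weight in [t] and a gamma weight in
    [s]. *)
Lemma gamma_wt_split (a b s t : R) : (0 < s)%R ->
  (s * (gamma_wt a (s * t) * gamma_wt b (s - s * t)) =
   half_pow a t * half_pow b (1 - t) * gamma_wt (a + b) s)%R.
Proof.
move=> s0; rewrite /gamma_wt /half_pow s0 pmulr_rgt0//.
have -> : (s - s * t = s * (1 - t))%R by ring.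
rewrite pmulr_rgt0//.
case: ifPn => t0; last by rewrite !(mul0r, mulr0).
case: ifPn => t1; last by rewrite !(mul0r, mulr0).
rewrite !powRM ?ltW//.
have -> : (s `^ (a + b - 1) = s `^ (a - 1) * s `^ (b - 1) * s)%R.
  rewrite -{4}(powRr1 (ltW s0)) -!powRD; first by congr powR; ring.
    by apply/implyP => _; rewrite gt_eqF.
  by apply/implyP => _; rewrite gt_eqF.
have -> : (- s / 2 = - (s * t) / 2 + - (s * (1 - t)) / 2)%R by ring.
by rewrite expRD; ring.
Qed.

(** The change of variables s = p + q, t = p / (p + q), done as the translation
    q = s - p for fixed [p], followed by the scaling p = s t for fixed [s].
    Taking [F] to depend on its second argument only gives the convolution of
    two gamma laws; an [F] that compares its two arguments gives the beta law
    of the ratio. *)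
Lemma beta_gamma (a b : R) (F : R -> R -> \bar R) :
  measurable_fun setT (fun z : R * R => F z.1 z.2) ->
  (forall x y, 0 <= F x y) ->
  \int[mu]_p \int[mu]_q (F p (p + q)%R * (gamma_wt a p * gamma_wt b q)%:E) =
  \int[mu]_s \int[mu]_t (F (s * t)%R s *
     (half_pow a t * half_pow b (1 - t) * gamma_wt (a + b) s)%:E).
Proof.
move=> mF F0.
have gg0 x y : 0 <= (gamma_wt a x * gamma_wt b y)%:E :> \bar R.
  by rewrite lee_fin mulr_ge0 ?gamma_wt_ge0.
transitivity (\int[mu]_p \int[mu]_s (F p s * (gamma_wt a p *
  gamma_wt b (s - p))%:E)).
  apply: eq_integral => p _.
  rewrite (ge0_integral_shift p); last 2 first.
  - by solve_measurable.
  - by move=> q; rewrite mule_ge0.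
  by apply: eq_integral => s _; rewrite addrC subrK.
etransitivity.
  refine (lebesgue_swap (fun p s =>
    F p s * (gamma_wt a p * gamma_wt b (s - p))%:E) _ _).
    by solve_measurable.
  by move=> p s; rewrite mule_ge0.
apply: eq_integral => s _.
have [s0|s0] := ltP 0%R s; last first.
  rewrite !integral0_eq// => t _;
    first by rewrite /gamma_wt /half_pow (ltNge _ s) s0/= !(mulr0, mul0r) mule0.
  rewrite /gamma_wt/half_pow; case: ifPn => t0;
    last by rewrite !(mulr0, mul0r) mule0.
  by rewrite subr_gt0 ltNge (le_trans s0 (ltW t0))/= !(mulr0, mul0r) mule0.
rewrite (ge0_integral_scale s)//; last 2 first.
- by solve_measurable.
- by move=> p; rewrite mule_ge0.
by apply: eq_integral => t _; rewrite muleCA -EFinM gamma_wt_split.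
Qed.

End beta_gamma.

(** * Symmetries of the Gaussian measure *)

Section normal.
Context {R : realType}.
Local Notation mu := (@lebesgue_measure R).
Local Notation std := (normal_prob (0 : R) 1).
Local Notation pdf := (normal_pdf (0 : R) 1).
Local Open Scope ereal_scope.

Lemma std_pdfE x : pdf x = (normal_peak 1 * expR (- x ^+ 2 / 2))%R.
Proof.
by rewrite normal_pdfE ?oner_eq0// /normal_fun subr0 expr1n.
Qed.

(** The Radon-Nikodym derivative of the measure agrees almost everywhere with
    the explicit density, since both have the same integral over each set. *)
Lemma ge0_integral_normal (f : R -> \bar R) :
  measurable_fun setT f -> (forall x, 0 <= f x) ->
  \int[std]_x f x = \int[mu]_x (f x * (pdf x)%:E).
Proof.
move=> mf f0; have dom := @normal_prob_dominates R 0%R 1%R.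
have mRN := Radon_Nikodym_SigmaFinite.f_integrable dom.
rewrite -(Radon_Nikodym_SigmaFinite.change_of_variables dom)//.
have mpdf : measurable_fun setT (fun x => (pdf x)%:E).
  by apply/measurable_EFinP; exact: measurable_normal_pdf.
apply: ae_eq_integral => //.
- by apply: emeasurable_funM => //; exact: measurable_int mRN.
- exact: emeasurable_funM.
- apply: ae_eqe_mul2l; apply: integral_ae_eq => //.
  by move=> A _ mA; rewrite -Radon_Nikodym_SigmaFinite.f_integral.
Qed.

Lemma pdf_ge0 x : 0 <= (pdf x)%:E.
Proof. by rewrite lee_fin normal_pdf_ge0. Qed.

Lemma measurable_pdf : measurable_fun setT pdf.
Proof. exact: measurable_normal_pdf. Qed.

Lemma ge0_integral_normalN (f : R -> \bar R) :
  measurable_fun setT f -> (forall x, 0 <= f x) ->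
  \int[std]_x f (- x)%R = \int[std]_x f x.
Proof.
move=> mf f0; rewrite !ge0_integral_normal//; last by solve_measurable.
have mp := measurable_pdf.
rewrite -[RHS](ge0_integral_affine (-1) 0)//; last 2 first.
- by solve_measurable.
- by move=> x; rewrite mule_ge0 ?pdf_ge0.
rewrite normrN1 mul1e; apply: eq_integral => x _.
by rewrite mulN1r addr0 !std_pdfE sqrrN.
Qed.

(** A rotation is a product of two shears and a scaling when s <> 0: first the
    inner variable is replaced by w = c x + s z, then the outer one by
    y = (c w - x) / s, each by an affine substitution in one variable. *)
Lemma lebesgue_rotation (g : R -> R) (c s : R) (H : R -> R -> \bar R) :
  (s != 0)%R -> (c ^+ 2 + s ^+ 2 = 1)%R ->
  measurable_fun setT g -> (forall x, (0 <= g x)%R) ->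
  (forall w y, g (c * w - s * y) * g (s * w + c * y) = g w * g y)%R ->
  measurable_fun setT (fun z : R * R => H z.1 z.2) ->
  (forall x y, 0 <= H x y) ->
  \int[mu]_x \int[mu]_z
    (H (c * x + s * z)%R (- s * x + c * z)%R * (g x * g z)%:E) =
  \int[mu]_x \int[mu]_z (H x z * (g x * g z)%:E).
Proof.
move=> s0 cs mg g0 grot mH H0.
transitivity (\int[mu]_x \int[mu]_w (`|s^-1|%:E *
    (H w ((c * w - x) / s)%R * (g x * g ((w - c * x) / s))%:E))).
  apply: eq_integral => x _.
  rewrite -(ge0_integral_affine s^-1 (- (c * x / s))); last 3 first.
  - by rewrite invr_eq0.
  - by solve_measurable.
  - by move=> z; rewrite mule_ge0// lee_fin mulr_ge0.
  rewrite -ge0_integralZl//; last 2 first.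
  - by solve_measurable.
  - by move=> z _; rewrite mule_ge0// lee_fin mulr_ge0.
  apply: eq_integral => w _; congr (_ * _).
  have -> : (s^-1 * w + - (c * x / s) = (w - c * x) / s)%R by ring.
  congr (H _ _ * _); first by field.
  have -> : (c * w - x = - s ^+ 2 * x + c * (w - c * x))%R.
    transitivity (c * w - 1 * x)%R; first by ring.
    by rewrite -cs; ring.
  by field.
etransitivity.
  refine (lebesgue_swap (fun x w => `|s^-1|%:E *
    (H w ((c * w - x) / s)%R * (g x * g ((w - c * x) / s))%:E)) _ _).
    by solve_measurable.
  by move=> x w; rewrite !mule_ge0// ?lee_fin ?mulr_ge0.
apply: eq_integral => w _.
rewrite -(ge0_integral_affine (- s) (c * w)); last 3 first.
- by rewrite oppr_eq0.
- by solve_measurable.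
- by move=> z; rewrite !mule_ge0// ?lee_fin ?mulr_ge0.
rewrite normrN -ge0_integralZl//; last 2 first.
- by solve_measurable.
- by move=> z _; rewrite !mule_ge0// ?lee_fin ?mulr_ge0.
apply: eq_integral => y _; rewrite muleA -EFinM -normrM divff// normr1 mul1e.
have -> : ((c * w - (- s * y + c * w)) / s = y)%R by field.
congr (_ * _%:E).
have -> : (w - c * (- s * y + c * w) = s * (s * w + c * y))%R.
  transitivity ((1 - c ^+ 2) * w + c * s * y)%R; first by ring.
  by rewrite -cs; ring.
rewrite -[in RHS]grot; congr (g _ * g _)%R; first by ring.
by field.
Qed.

(** The product density depends on x ^ 2 + z ^ 2 only. *)
Lemma normal_rotation (c s : R) (H : R -> R -> \bar R) :
  (s != 0)%R -> (c ^+ 2 + s ^+ 2 = 1)%R ->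
  measurable_fun setT (fun z : R * R => H z.1 z.2) ->
  (forall x y, 0 <= H x y) ->
  \int[std]_x \int[std]_z H (c * x + s * z)%R (- s * x + c * z)%R =
  \int[std]_x \int[std]_z H x z.
Proof.
move=> s0 cs mH H0.
have mp := measurable_pdf.
have p0 x : (0 <= pdf x)%R by exact: normal_pdf_ge0.
have stdE (G : R -> R -> \bar R) :
    measurable_fun setT (fun z : R * R => G z.1 z.2) ->
    (forall x y, 0 <= G x y) ->
    \int[std]_x \int[std]_z G x z =
    \int[mu]_x \int[mu]_z (G x z * (pdf x * pdf z)%:E).
  move=> mG G0; rewrite ge0_integral_normal; last 2 first.
  - exact: measurable_fun_integral.
  - by move=> x; apply: integral_ge0.
  apply: eq_integral => x _.
  rewrite ge0_integral_normal//; last by solve_measurable.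
  rewrite -ge0_integralZr//; last 3 first.
  - by solve_measurable.
  - by move=> z _; rewrite mule_ge0 ?pdf_ge0.
  - by rewrite pdf_ge0.
  by apply: eq_integral => z _; rewrite -muleA -EFinM mulrC.
rewrite [LHS]stdE//; last by solve_measurable.
rewrite (stdE H mH H0).
apply: lebesgue_rotation => // w y.
rewrite !std_pdfE mulrACA [in RHS]mulrACA -!expRD; congr (_ * expR _)%R.
transitivity ((c ^+ 2 + s ^+ 2) * (- w ^+ 2 / 2 + - y ^+ 2 / 2))%R;
  first by field.
by rewrite cs mul1r.
Qed.

End normal.

(** * The square of a Gaussian variable *)

Section squares.
Context {R : realType}.
Local Notation mu := (@lebesgue_measure R).
Local Notation std := (normal_prob (0 : R) 1).
Local Notation pdf := (normal_pdf (0 : R) 1).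
Local Open Scope ereal_scope.

Lemma half_pow1E (x : R) : (half_pow 1 x = (0 < x)%R%:R)%R.
Proof. by rewrite /half_pow; case: ifPn => // _; rewrite subrr powRr0. Qed.

(** The squared half-normal variable has a gamma law of shape 1 / 2. The factor
    [k] is left unspecified: total mass 1 determines it in
    [half_normal_density]. *)
Lemma half_normal_sqr : exists2 k : \bar R, 0 <= k &
  forall g : R -> \bar R, measurable_fun setT g -> (forall x, 0 <= g x) ->
  \int[std]_x ((half_pow 1 x)%:E * g (x ^+ 2)%R) =
  k * \int[mu]_t (g t * (gamma_wt 2^-1 t)%:E).
Proof.
(* a test function whose integral against dt / t is 1 *)
pose h (t : R) : \bar R := (t * \1_`[1%R, 2%R] t)%:E.
have mh : measurable_fun setT h.
  by apply/measurable_EFinP; apply: measurable_funM => //;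
    exact: measurable_indic.
have h0 t : 0 <= h t.
  rewrite lee_fin indicE; case: (boolP (t \in _)); last by rewrite mulr0.
  by rewrite inE/= in_itv/= mulr1 => /andP[+ _]; exact: le_trans.
have h1 : \int[mu]_t (h t * (half_pow 0 t)%:E) = 1.
  transitivity (\int[mu]_t (\1_`[1%R, 2%R] t)%:E).
    apply: eq_integral => t _; rewrite -EFinM indicE.
    case: (boolP (t \in _)); last by rewrite mulr0 mul0r.
    rewrite inE/= in_itv/= mulr1 => /andP[t1 _].
    have t0 : (0 < t)%R by exact: lt_le_trans t1.
    by rewrite /half_pow t0 sub0r powR_inv1 ?ltW// divff// gt_eqF.
  rewrite integral_indic// setIT; transitivity ((2 - 1)%:E : \bar R).
    by rewrite [LHS]lebesgue_measure_itv/= lte_fin ltr1n.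
  by congr EFin; ring.
pose D := \int[mu]_x (h (x `^ (- 2))%R * (half_pow 0 x)%:E).
have c0 : (0 <= normal_peak (1 : R))%R by exact: normal_peak_ge0.
exists (D * (normal_peak 1)%:E).
  rewrite mule_ge0// integral_ge0// => x _.
  by rewrite mule_ge0// lee_fin half_pow_ge0.
move=> g mg g0; rewrite ge0_integral_normal; last 2 first.
- by solve_measurable.
- by move=> x; rewrite mule_ge0// lee_fin half_pow_ge0.
(* chosen so that f (x ^ 2) / x is g (x ^ 2) times the Gaussian density *)
pose f (t : R) := g t * (normal_peak 1 * (t `^ 2^-1 * expR (- t / 2)))%:E.
have mf : measurable_fun setT f by rewrite /f; solve_measurable.
have f0 t : 0 <= f t.
  by rewrite mule_ge0// lee_fin !mulr_ge0 ?powR_ge0 ?expR_ge0.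
have := ge0_integral_haar_sqr f h mf f0 mh h0.
rewrite h1 mule1 => fE.
transitivity (\int[mu]_x (f (x ^+ 2)%R * (half_pow 0 x)%:E)).
  apply: eq_integral => x _; rewrite /f half_pow1E /half_pow.
  case: ltP => x0; last by rewrite mul0e mul0e mule0.
  rewrite mul1e -muleA -EFinM; congr (_ * _%:E).
  rewrite std_pdfE -powR_mulrn ?ltW// -powRrM divff ?pnatr_eq0//.
  rewrite powRr1 ?ltW// sub0r powR_inv1 ?ltW//.
  by field; rewrite gt_eqF.
rewrite fE -muleA; congr (_ * _); rewrite -ge0_integralZl//; last 2 first.
- by solve_measurable.
- by move=> t _; rewrite mule_ge0// lee_fin gamma_wt_ge0.
apply: eq_integral => t _.
rewrite /f /gamma_wt /half_pow; case: ltP => t0; last first.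
  by rewrite mul0r !mule0.
rewrite -muleA [RHS]muleCA; congr (_ * _); rewrite -!EFinM; congr EFin.
rewrite [in RHS]powRD; last by apply/implyP => _; rewrite gt_eqF.
by rewrite sub0r; ring.
Qed.

(** The two half-lines contribute equally and the origin is a null set. *)
Lemma normal_even (f : R -> \bar R) : measurable_fun setT f ->
  (forall x, 0 <= f x) -> (forall x, f (- x)%R = f x) ->
  \int[std]_x f x = 2%:E * \int[std]_x ((half_pow 1 x)%:E * f x).
Proof.
move=> mf f0 fN; have mp := @measurable_pdf R.
have hf0 x : 0 <= (half_pow 1 x)%:E * f x
  by rewrite mule_ge0// lee_fin half_pow_ge0.
have mhf : measurable_fun setT (fun x => (half_pow 1 x)%:E * f x)
  by solve_measurable.
rewrite (_ : 2%:E = 1 + 1) // ge0_muleDl// mul1e.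
rewrite -[X in X + _]ge0_integral_normalN//.
rewrite -ge0_integralD//; last by solve_measurable.
rewrite !ge0_integral_normal//; last 2 first.
- by apply: emeasurable_funD => //; solve_measurable.
- by move=> x; rewrite adde_ge0.
apply: ae_eq_integral => //.
- by solve_measurable.
- by apply: emeasurable_funM; [apply: emeasurable_funD => //|];
    solve_measurable.
exists [set 0%R]; split => //; first exact: lebesgue_measure_set1.
move=> x /=; apply: contra_notP => /eqP x0 _.
rewrite fN -ge0_muleDl ?lee_fin ?half_pow_ge0// -EFinD !half_pow1E oppr_gt0.
by case: (ltgtP x 0%R) x0 => // _ _; rewrite ?add0r ?addr0 mul1e.
Qed.

(** Gamma laws of equal scale are stable under convolution, up to a
    beta integral, which total mass 1 determines later. *)
Lemma gamma_wt_convolution (a b : R) (g : R -> \bar R) :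
  measurable_fun setT g -> (forall x, 0 <= g x) ->
  \int[mu]_p \int[mu]_q (g (p + q)%R * (gamma_wt a p * gamma_wt b q)%:E) =
  (\int[mu]_t (half_pow a t * half_pow b (1 - t))%:E) *
  \int[mu]_s (g s * (gamma_wt (a + b) s)%:E).
Proof.
move=> mg g0; rewrite (beta_gamma a b (fun _ s => g s))//;
  last by solve_measurable.
have bb0 t : 0 <= (half_pow a t * half_pow b (1 - t))%:E :> \bar R.
  by rewrite lee_fin mulr_ge0 ?half_pow_ge0.
have gg0 s : 0 <= g s * (gamma_wt (a + b) s)%:E
  by rewrite mule_ge0// lee_fin gamma_wt_ge0.
rewrite -ge0_integralZl//; last 2 first.
- by solve_measurable.
- by rewrite integral_ge0.
apply: eq_integral => s _.
rewrite muleC -ge0_integralZl//; last by solve_measurable.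
by apply: eq_integral => t _; rewrite EFinM muleA muleAC.
Qed.

End squares.

(** * Independence of a variable from the preceding ones *)

(** Independence of [X] and [Y], given on measurable rectangles, says that the
    law of the pair is the product measure, by uniqueness of the latter. *)
Lemma ge0_integral_indep d d1 d2 (Omega : measurableType d)
    (T1 : measurableType d1) (T2 : measurableType d2) (R : realType)
    (P : probability Omega R) (nu : probability T2 R)
    (X : Omega -> T1) (Y : Omega -> T2) (F : T1 -> T2 -> \bar R) :
  measurable_fun setT X -> measurable_fun setT Y ->
  (forall A B, measurable A -> measurable B ->
     P (X @^-1` A `&` Y @^-1` B) = P (X @^-1` A) * nu B)%E ->
  measurable_fun setT (fun z : T1 * T2 => F z.1 z.2) ->
  (forall x z, 0 <= F x z)%E ->
  (\int[P]_w F (X w) (Y w) = \int[P]_w \int[nu]_z F (X w) z)%E.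
Proof.
move=> mX mY XY mF F0.
have mZ : measurable_fun setT (fun w => (X w, Y w)).
  by apply: measurable_fun_pair.
pose X1 : {mfun Omega >-> T1} := mfun_Sub (mem_set mX).
pose Z : {mfun Omega >-> (T1 * T2)%type} := mfun_Sub (mem_set mZ).
have mFi : measurable_fun setT (fun x => \int[nu]_z F x z)%E.
  exact: measurable_fun_integral.
transitivity (\int[distribution P Z]_z F z.1 z.2)%E.
  by rewrite ge0_integral_distribution.
transitivity (\int[distribution P X1]_x \int[nu]_z F x z)%E; last first.
  by rewrite ge0_integral_distribution// => x; exact: integral_ge0.
transitivity (\int[distribution P X1 \x nu]_z F z.1 z.2)%E; last first.
  by rewrite fubini_tonelli1.
apply: eq_measure_integral => S mS _.
by apply/esym/product_measure_unique => // A B mA mB; exact: XY.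
Qed.

Section independence.
Context {R : realType} {d : measure_display} {Omega : measurableType d}.
Variables (P : probability Omega R) (n : nat) (xi : 'I_n -> {RV P >-> R}).
Hypothesis hxi : std_gaussian xi.
Local Notation std := (normal_prob (0 : R) 1).

(** The pi-system of the rectangles in the first [k] variables; it generates the
    sigma-algebra of these variables. *)
Definition past_events (k : nat) : set (set Omega) :=
  [set E | exists2 A : 'I_n -> set R, (forall j, measurable (A j)) &
     E = [set w | forall j : 'I_n, (j < k)%N -> A j (xi j w)]].

Lemma past_measurable k : <<s past_events k>> `<=` measurable.
Proof.
apply: smallest_sub; first exact: sigma_algebra_measurable.
move=> _ [A mA ->].
rewrite (_ : [set w | _] =
  \bigcap_(j in [set j : 'I_n | (j < k)%N]) (xi j @^-1` A j)).
  apply: fin_bigcap_measurable => // j _; exact: measurable_funPTI.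
by apply/seteqP; split => w /=.
Qed.

Lemma past_setI k : setI_closed (past_events k).
Proof.
move=> _ _ [A mA ->] [B mB ->].
exists (fun j => A j `&` B j); first by move=> j; exact: measurableI.
apply/seteqP; split => w /= => [[wA wB] j jk|wAB].
  by split; [exact: wA|exact: wB].
by split => j /wAB[].
Qed.

(** Both sides are finite measures in [E]. They agree on rectangles by mutual
    independence, and rectangles are stable under intersection, so they agree
    on the generated sigma-algebra. *)
Lemma past_indep (k : 'I_n) (E : set Omega) (B : set R) :
  <<s past_events k>> E -> measurable B ->
  (P (E `&` xi k @^-1` B) = P E * std B)%E.
Proof.
move=> pE mB; have [xiN xiI] := hxi.
have mxB : measurable (xi k @^-1` B) by exact: measurable_funPTI.
have sB0 : 0 <= fine (std B) by exact: fine_ge0.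
pose m1 : {measure set Omega -> \bar R} := mrestr P mxB.
pose m2 : {measure set Omega -> \bar R} := mscale (NngNum sB0) P.
have -> : (P E * std B)%E = m2 E.
  by rewrite /m2/= /mscale/= fineK ?fin_num_measure// muleC.
rewrite -[LHS]/(m1 E).
apply: (g_sigma_algebra_measure_unique (past_events k) _ (fun=> setT)) pE.
- by move=> X pX; apply: (past_measurable k); exact: sub_sigma_algebra.
- by move=> _; exists (fun=> setT) => //; apply/seteqP; split.
- by rewrite bigcup_const//; exists 0%N.
- exact: past_setI.
- move=> _ [A mA ->].
  rewrite /m1 /m2 /= /mrestr /mscale/= fineK ?fin_num_measure//.
  pose J := [set j : 'I_n | (j < k)%N]%SET.
  have kJ : k \notin J by rewrite inE ltnn.
  pose A' j := if j == k then B else A j.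
  have mA' j : measurable (A' j) by rewrite /A'; case: ifP.
  have AJ j : j \in J -> A' j = A j.
    by rewrite /A'; case: eqP => // ->; rewrite (negbTE kJ).
  have -> : [set w | forall j : 'I_n, (j < k)%N -> A j (xi j w)]
      `&` xi k @^-1` B =
      [set w | forall j, j \in (k |: J)%SET -> A' j (xi j w)].
    apply/seteqP; split => w /=.
      move=> [wA wB] j; rewrite in_setU1 => /orP[/eqP ->|jJ].
        by rewrite /A' eqxx.
      by rewrite AJ//; apply: wA; move: jJ; rewrite inE.
    move=> wA; split => [j jk|].
      by have := wA j; rewrite in_setU1 inE jk orbT AJ ?inE//; exact.
    by have := wA k; rewrite in_setU1 eqxx /A' eqxx; exact.
  have -> : [set w | forall j : 'I_n, (j < k)%N -> A j (xi j w)] =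
      [set w | forall j, j \in J -> A j (xi j w)].
    by apply/seteqP; split => w /= wA j jk; apply: wA; move: jk; rewrite inE.
  rewrite !xiI// big_setU1//= {1}/A' eqxx.
  rewrite -[X in (X * _)%E]/(distribution P (xi k) B) xiN//.
  by congr (_ * _)%E; apply: eq_bigr => j jJ; rewrite AJ.
- move=> _; apply: (@le_lt_trans _ _ 1%E); last exact: ltry.
  by apply: probability_le1; exact: measurableI.
Qed.

(** A function of the first [k] variables is independent of the next one, so
    this variable can be integrated out first. *)
Lemma indep_integral (k : 'I_n) d' (T' : measurableType d') (X : Omega -> T')
    (F : T' -> R -> \bar R) :
  measurable_fun setT (X : g_sigma_algebraType (past_events k) -> T') ->
  measurable_fun setT (fun z : T' * R => F z.1 z.2) ->
  (forall x z, 0 <= F x z)%E ->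
  (\int[P]_w F (X w) (xi k w) = \int[P]_w \int[std]_z F (X w) z)%E.
Proof.
move=> mX mF F0.
have pX A : measurable A -> <<s past_events k>> (X @^-1` A).
  by move=> mA; have := mX measurableT A mA; rewrite setTI.
have mX' : measurable_fun setT X.
  by move=> _ A mA; rewrite setTI; apply: past_measurable; exact: pX.
apply: (@ge0_integral_indep _ _ _ _ _ (measurableTypeR R) R P std X (xi k) F)
  => //.
  have mxi : measurable_fun setT (xi k) by [].
  exact: mxi.
by move=> A B mA mB; exact: past_indep (pX _ mA) mB.
Qed.

End independence.

(** * The joint law of a linear form and the squared norm *)

Section gaussian_vector.
Context {R : realType} {d : measure_display} {Omega : measurableType d}.
Variables (P : probability Omega R) (n : nat) (xi : 'I_n -> {RV P >-> R}).
Hypothesis hxi : std_gaussian xi.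
Local Notation mu := (@lebesgue_measure R).
Local Notation std := (normal_prob (0 : R) 1).
Implicit Types (a : 'I_n -> R) (k : nat) (w : Omega).

(** Prefix sums, so that an induction on [k] brings in one Gaussian variable
    at a time. *)
Definition prefix_dot a k w : R := \sum_(j < n | (j < k)%N) a j * xi j w.

Definition prefix_sqnorm k w : R := \sum_(j < n | (j < k)%N) xi j w ^+ 2.

Lemma ord_sumS k (kn : (k < n)%N) (f : 'I_n -> R) :
  \sum_(j < n | (j < k.+1)%N) f j =
  \sum_(j < n | (j < k)%N) f j + f (Ordinal kn).
Proof.
rewrite (bigD1 (Ordinal kn))//= addrC; congr (_ + _).
by apply: eq_bigl => j; rewrite -val_eqE/= ltnS ltn_neqAle andbC.
Qed.

Lemma ord_sum0 (f : 'I_n -> R) : \sum_(j < n | (j < 0)%N) f j = 0.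
Proof. by rewrite big_pred0. Qed.

Lemma past_measurable_xi k (j : 'I_n) : (j < k)%N ->
  measurable_fun setT (xi j : g_sigma_algebraType (past_events P n xi k) -> R).
Proof.
move=> jk _ B mB; rewrite setTI; apply: sub_sigma_algebra.
exists (fun i => if i == j then B else setT); first by move=> i; case: ifP.
apply/seteqP; split => w /= => [wB i ik|]; first by case: eqP => // ->.
by move=> /(_ j jk); rewrite eqxx.
Qed.

Lemma past_measurable_sum k (f : 'I_n -> R -> R) :
  (forall j, measurable_fun setT (f j)) ->
  measurable_fun setT ((fun w => \sum_(j < n | (j < k)%N) f j (xi j w))
    : g_sigma_algebraType (past_events P n xi k) -> R).
Proof.
move=> mf; rewrite [X in measurable_fun _ X](_ : _ = fun w =>
    \sum_(j < n) (if (j < k)%N then f j (xi j w) else 0)); last first.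
  by apply/funext => w; exact: big_mkcond.
apply: measurable_sum => j; case: ltnP => [jk|_]; last exact: measurable_cst.
by apply: (measurableT_comp (mf j)); exact: past_measurable_xi.
Qed.

Lemma past_measurable_prefix_dot a k :
  measurable_fun setT (prefix_dot a k :
    g_sigma_algebraType (past_events P n xi k) -> R).
Proof.
by apply: (past_measurable_sum k (fun j x => a j * x)) => j;
  exact: measurable_funM.
Qed.

Lemma past_measurable_prefix_sqnorm k :
  measurable_fun setT (prefix_sqnorm k :
    g_sigma_algebraType (past_events P n xi k) -> R).
Proof.
by apply: (past_measurable_sum k (fun j x => x ^+ 2)) => j;
  exact: measurable_funX.
Qed.

Lemma measurable_prefix_dot a k : measurable_fun setT (prefix_dot a k).
Proof.
rewrite (_ : prefix_dot a k = fun w =>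
    \sum_(j < n) (if (j < k)%N then a j * xi j w else 0)); last first.
  by apply/funext => w; exact: big_mkcond.
apply: measurable_sum => j; case: ltnP => [jk|_]; last exact: measurable_cst.
exact: measurable_funM.
Qed.

Lemma measurable_prefix_sqnorm k : measurable_fun setT (prefix_sqnorm k).
Proof.
rewrite (_ : prefix_sqnorm k = fun w =>
    \sum_(j < n) (if (j < k)%N then xi j w ^+ 2 else 0)); last first.
  by apply/funext => w; exact: big_mkcond.
apply: measurable_sum => j; case: ltnP => [jk|_]; last exact: measurable_cst.
exact: measurable_funX.
Qed.

Lemma integral_xi (j : 'I_n) (g : R -> \bar R) :
  measurable_fun setT g -> (forall x, (0 <= g x)%E) ->
  (\int[P]_w g (xi j w) = \int[std]_z g z)%E.
Proof.
move=> mg g0; have [xiN _] := hxi.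
have mxi : measurable_fun setT (xi j) by [].
pose m := image_measure _ _ _ P _ mxi.
transitivity (\int[m]_z g z)%E; first by rewrite ge0_integral_pushforward.
by apply: eq_measure_integral => A mA _; exact: xiN.
Qed.

(** Each new square contributes a gamma law of shape 1 / 2 that is independent
    of the preceding ones, so shapes add up to (k + 1) / 2 by
    [gamma_wt_convolution]. *)
Lemma prefix_sqnorm_law k : (k < n)%N -> exists2 C : \bar R, (0 <= C)%E &
  forall g : R -> \bar R, measurable_fun setT g -> (forall x, (0 <= g x)%E) ->
  (\int[P]_w g (prefix_sqnorm k.+1 w) =
   C * \int[mu]_t (g t * (gamma_wt (k.+1%:R / 2) t)%:E))%E.
Proof.
have [c c0 cE] := @half_normal_sqr R.
elim: k => [|k IH] kn.
  exists (2%:E * c)%E; first by rewrite mule_ge0.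
  move=> g mg g0.
  transitivity (\int[P]_w g (xi (Ordinal kn) w ^+ 2)%R)%E.
    apply: eq_integral => w _; congr g.
    by rewrite /prefix_sqnorm (ord_sumS 0 kn) ord_sum0 add0r.
  rewrite (integral_xi (Ordinal kn) (fun z => g (z ^+ 2)))//;
    last by solve_measurable.
  rewrite normal_even; last 3 first.
  - by solve_measurable.
  - by [].
  - by move=> x; rewrite sqrrN.
  by rewrite cE// mul1r muleA.
have [C C0 CE] := IH (ltnW kn).
exists (C * (2%:E * c * \int[mu]_t (half_pow (k.+1%:R / 2) t *
  half_pow 2^-1 (1 - t))%:E))%E.
  rewrite !mule_ge0// integral_ge0// => t _.
  by rewrite lee_fin mulr_ge0 ?half_pow_ge0.
move=> g mg g0.
pose G v := (\int[std]_z g (v + z ^+ 2)%R)%E.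
have mg2 : measurable_fun setT (fun z : R * R => g (z.1 + z.2 ^+ 2))
  by solve_measurable.
have mG : measurable_fun setT G.
  by refine (@measurable_fun_integral _ _ R (measurableTypeR R) R std
    (fun v z : R => g (v + z ^+ 2)) mg2 _).
have G0 v : (0 <= G v)%E by exact: integral_ge0.
transitivity (\int[P]_w G (prefix_sqnorm k.+1 w))%E.
  transitivity (\int[P]_w g (prefix_sqnorm k.+1 w +
    xi (Ordinal kn) w ^+ 2)%R)%E.
    by apply: eq_integral => w _; rewrite /prefix_sqnorm (ord_sumS _ kn).
  apply: (indep_integral _ _ _ hxi (Ordinal kn) _ R (prefix_sqnorm k.+1)
    (fun x z => g (x + z ^+ 2))) => //.
  exact: past_measurable_prefix_sqnorm.
rewrite (CE G mG G0).
have -> : k.+2%:R / 2 = k.+1%:R / 2 + 2^-1 :> R.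
  by rewrite -[k.+2%:R]natr1 mulrDl mul1r.
rewrite -!muleA -gamma_wt_convolution//; congr (C * _)%E.
rewrite muleA -ge0_integralZl//; last 3 first.
- refine (@measurable_fun_integral _ _ R (measurableTypeR R) R mu
    (fun p q : R => g (p + q)%R *
      (gamma_wt (k.+1%:R / 2) p * gamma_wt 2^-1 q)%:E)%E _ _).
    have mgD : measurable_fun setT (fun z : R * R => g (z.1 + z.2))
      by solve_measurable.
    by solve_measurable.
  by move=> p q; rewrite mule_ge0// lee_fin mulr_ge0 ?gamma_wt_ge0.
- by move=> p _; apply: integral_ge0 => q _;
    rewrite mule_ge0// lee_fin mulr_ge0 ?gamma_wt_ge0.
- by rewrite mule_ge0.
apply: eq_integral => p _.
rewrite /G normal_even; last 3 first.
- by solve_measurable.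
- by [].
- by move=> x; rewrite sqrrN.
have mgp : measurable_fun setT (fun t : R => g (p + t)) by solve_measurable.
have /= -> := cE _ mgp (fun t => g0 (p + t)).
rewrite -!muleA; congr (_ * (_ * _))%E.
rewrite -ge0_integralZr//; last 3 first.
- by solve_measurable.
- by move=> t _; rewrite mule_ge0// lee_fin gamma_wt_ge0.
- by rewrite lee_fin gamma_wt_ge0.
by apply: eq_integral => q _; rewrite -muleA -EFinM mulrC.
Qed.

(** A linear form in k + 1 independent Gaussian variables, together with the
    squared norm of these, is distributed as (r W, W ^ 2 + T), where [W] is
    Gaussian and [T], independent of [W], is the squared norm of [k] Gaussian
    variables. When a variable z joins with coefficient [a i], the form becomes
    r W + a i z, and rotating the plane of (W, z) makes this r' W'; the second
    rotated coordinate is independent of [W'] and its square adds to [T].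
    This replaces the rotation of the whole space that takes the coefficient
    vector to a coordinate axis. *)
Lemma joint_law a k : (k < n)%N -> exists2 r : R,
  r ^+ 2 = \sum_(j < n | (j < k.+1)%N) a j ^+ 2 &
  forall F : R -> R -> \bar R,
  measurable_fun setT (fun z : R * R => F z.1 z.2) ->
  (forall x y, (0 <= F x y)%E) ->
  (\int[P]_w F (prefix_dot a k.+1 w) (prefix_sqnorm k.+1 w) =
   \int[P]_w \int[std]_x F (r * x)%R (x ^+ 2 + prefix_sqnorm k w)%R)%E.
Proof.
elim: k => [|k IH] kn; set i := Ordinal kn.
  exists (a i); first by rewrite (ord_sumS 0 kn) ord_sum0 add0r.
  move=> F mF F0.
  transitivity (\int[P]_w F (a i * xi i w)%R
      (xi i w ^+ 2 + prefix_sqnorm 0 w)%R)%E.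
    apply: eq_integral => w _.
    by rewrite /prefix_dot /prefix_sqnorm !(ord_sumS 0 kn) !ord_sum0 !add0r
      addr0.
  apply: (indep_integral _ _ _ hxi i _ R (prefix_sqnorm 0)
    (fun v x => F (a i * x) (x ^+ 2 + v))) => //; last by solve_measurable.
  exact: past_measurable_prefix_sqnorm.
have [r rE rlaw] := IH (ltnW kn).
(* the rotation has sine a i / r', and [normal_rotation] divides by it *)
pose r' := if a i == 0 then r else Num.sqrt (r ^+ 2 + a i ^+ 2).
have r'E : r' ^+ 2 = r ^+ 2 + a i ^+ 2.
  rewrite /r'; case: eqP => [->|_]; first by rewrite expr0n/= addr0.
  by rewrite sqr_sqrtr// addr_ge0 ?sqr_ge0.
exists r'; first by rewrite r'E (ord_sumS _ kn) rE.
move=> F mF F0.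
pose F1 u v := (\int[std]_z F (u + a i * z)%R (v + z ^+ 2)%R)%E.
have mF1 : measurable_fun setT (fun z : R * R => F1 z.1 z.2).
  refine (@measurable_fun_integral _ _ (R * R)%type (measurableTypeR R) R std
    (fun u z => F (u.1 + a i * z)%R (u.2 + z ^+ 2)%R) _ _) => //.
  by solve_measurable.
transitivity (\int[P]_w F1 (prefix_dot a k.+1 w) (prefix_sqnorm k.+1 w))%E.
  transitivity (\int[P]_w F (prefix_dot a k.+1 w + a i * xi i w)%R
      (prefix_sqnorm k.+1 w + xi i w ^+ 2)%R)%E.
    by apply: eq_integral => w _;
      rewrite /prefix_dot /prefix_sqnorm !(ord_sumS _ kn).
  apply: (indep_integral _ _ _ hxi i _ (R * R)%type
    (fun w => (prefix_dot a k.+1 w, prefix_sqnorm k.+1 w))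
    (fun u z => F (u.1 + a i * z)%R (u.2 + z ^+ 2)%R)) => //;
      last by solve_measurable.
  apply: measurable_fun_pair; [exact: past_measurable_prefix_dot|].
  exact: past_measurable_prefix_sqnorm.
have F10 x y : (0 <= F1 x y)%E by exact: integral_ge0.
rewrite (rlaw F1 mF1 F10).
pose G (v y : R) := (\int[std]_x F (r' * x)%R (x ^+ 2 + (v + y ^+ 2))%R)%E.
have mG : measurable_fun setT (fun z : R * R => G z.1 z.2).
  refine (@measurable_fun_integral _ _ (R * R)%type (measurableTypeR R) R std
    (fun u x => F (r' * x)%R (x ^+ 2 + (u.1 + u.2 ^+ 2))%R) _ _) => //.
  by solve_measurable.
transitivity (\int[P]_w \int[std]_y G (prefix_sqnorm k w) y)%E; last first.
  transitivity (\int[P]_w G (prefix_sqnorm k w) (xi (Ordinal (ltnW kn)) w))%E.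
    apply/esym; apply: (indep_integral _ _ _ hxi (Ordinal (ltnW kn)) _ R
      (prefix_sqnorm k) G) => //.
      exact: past_measurable_prefix_sqnorm.
    by move=> x y; exact: integral_ge0.
  by apply: eq_integral => w _; rewrite /prefix_sqnorm (ord_sumS _ (ltnW kn)).
apply: eq_integral => w _; rewrite /F1 /G.
transitivity (\int[std]_x \int[std]_y F (r' * x)%R
    (x ^+ 2 + y ^+ 2 + prefix_sqnorm k w)%R)%E; last first.
  etransitivity.
    refine (@ge0_integral_swap _ _ (measurableTypeR R) (measurableTypeR R) R
      std std
      (fun x y => F (r' * x)%R (x ^+ 2 + y ^+ 2 +
        prefix_sqnorm k w)%R) _ _) => //.
    by solve_measurable.
  apply: eq_integral => y _; apply: eq_integral => x _.
  by congr F; ring.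
have [a0|a0] := eqVneq (a i) 0.
  rewrite /r' a0 eqxx; apply: eq_integral => x _; apply: eq_integral => z _.
  by congr F; ring.
have r'0 : r' != 0.
  rewrite -sqrf_eq0 r'E gt_eqF// ltr_wpDl ?sqr_ge0//.
  by rewrite exprn_even_gt0.
pose H x y := F (r' * x)%R (x ^+ 2 + y ^+ 2 + prefix_sqnorm k w)%R.
rewrite -(normal_rotation (r / r') (a i / r') H); last 4 first.
- by rewrite mulf_neq0// invr_eq0.
- by rewrite !expr_div_n -mulrDl -r'E divff// sqrf_eq0.
- by rewrite /H; solve_measurable.
- by move=> x y; exact: F0.
apply: eq_integral => x _; apply: eq_integral => z _; rewrite /H.
congr F; first by field.
transitivity ((r ^+ 2 + a i ^+ 2) / r' ^+ 2 *
  (x ^+ 2 + z ^+ 2) + prefix_sqnorm k w).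
  by rewrite -r'E divff ?sqrf_eq0// mul1r; ring.
by field.
Qed.

End gaussian_vector.

(** * Normalising constants *)

Section constants.
Context {R : realType}.
Local Notation mu := (@lebesgue_measure R).
Local Notation std := (normal_prob (0 : R) 1).

(** How total mass 1 forces the implicit constants and the integrals of the
    gamma weights to be finite and positive. *)
Lemma mule_eq_pos (x y : \bar R) (r : R) : (0 <= x)%E -> (0 <= y)%E -> 0 < r ->
  (x * y = r%:E)%E ->
  exists2 s : R, 0 < s & y = s%:E /\ x = (r / s)%:E.
Proof.
move=> x0 y0 r0 xy.
have xn0 : x != 0%E by apply: contra_eq_neq xy => ->;
  rewrite mul0e eq_sym eqe gt_eqF.
have yn0 : y != 0%E by apply: contra_eq_neq xy => ->;
  rewrite mule0 eq_sym eqe gt_eqF.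
have {xn0}x1 : (0 < x)%E by rewrite lt0e xn0.
have {yn0}y1 : (0 < y)%E by rewrite lt0e yn0.
case: y => [s| |] in y0 y1 xy *; last by [].
  exists s => //; split=> //; case: x => [t| |] in x0 x1 xy *; last by [].
    by move: xy; rewrite -EFinM => -[<-]; rewrite mulfK// gt_eqF.
  by move: xy; rewrite gt0_mulye.
by move: xy; rewrite gt0_muley.
Qed.

Lemma integral_half_pow (a : R) (f : R -> R) :
  (\int[mu]_(t in `]0%R, +oo[) (t `^ (a - 1) * f t)%:E =
   \int[mu]_t (half_pow a t * f t)%:E)%E.
Proof.
rewrite integral_mkcond; apply: eq_integral => t _.
rewrite patchE /half_pow; case: (ltP 0 t) => t0.
  by rewrite mem_set// /= in_itv/= t0.
by rewrite memNset ?mul0r//= in_itv/= andbT ltNge t0.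
Qed.

(** Finiteness matters because [Gamma] is defined by a real-valued integral,
    which carries no information when the integral diverges. *)
Lemma integral_gamma_wt_fin (a : R) :
  (\int[mu]_t (gamma_wt a t)%:E < +oo)%E ->
  (\int[mu]_t (gamma_wt a t)%:E = (2 `^ a * Gamma a)%:E)%E.
Proof.
(* the scaling t |-> 2 t, valid for infinite integrals too *)
have E : (\int[mu]_t (gamma_wt a t)%:E =
    (2 `^ a)%:E * \int[mu]_(t in `]0%R, +oo[) (t `^ (a - 1) * expR (- t))%:E)%E.
  rewrite integral_half_pow (ge0_integral_scale 2 (fun t =>
    (gamma_wt a t)%:E))//; last 2 first.
  - by solve_measurable.
  - by move=> x; rewrite lee_fin gamma_wt_ge0.
  rewrite -[RHS]ge0_integralZl//; last 2 first.
  - by solve_measurable.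
  - by move=> t _; rewrite lee_fin mulr_ge0 ?half_pow_ge0 ?expR_ge0.
  apply: eq_integral => t _; rewrite /gamma_wt /half_pow -!EFinM; congr EFin.
  rewrite pmulr_rgt0//; case: (ltP 0 t) => t0; last by rewrite !mul0r !mulr0.
  have -> : (2 : R) `^ a = 2 `^ (a - 1) * 2.
    rewrite -{1}(subrK 1 a) [in LHS]powRD; last by apply/implyP => _;
      rewrite pnatr_eq0.
    by rewrite powRr1.
  rewrite powRM ?ltW//; have -> : (- (2 * t) / 2 = - t) by field.
  by ring.
move=> foo; rewrite E EFinM; congr (_ * _)%E.
rewrite /Gamma /Rintegral fineK// ge0_fin_numE; last first.
  by apply: integral_ge0 => t _; rewrite lee_fin mulr_ge0 ?powR_ge0 ?expR_ge0.
move: foo; rewrite E.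
set I := (X in (_ * X)%E); rewrite -[X in _ -> (X < _)%E]/I;
  case: I => [s _| |//]; first exact: ltry.
by rewrite gt0_muley ?ltxx// lte_fin powR_gt0.
Qed.

Lemma mule_fine (c : R) (x y : \bar R) : 0 < c -> x \is a fin_num ->
  x = (c%:E * y)%E -> x = (c * fine y)%:E.
Proof.
move=> c0 + xE; rewrite xE EFinM; case: y {xE} => [y| |] //.
  by rewrite gt0_muley.
by rewrite gt0_muleNy.
Qed.

(** The total mass of [gamma_wt a]. *)
Definition gamma_mass (a : R) : R := 2 `^ a * Gamma a.

(** The constant function 1 identifies the factor: the half-line has
    probability 1 / 2. *)
Lemma half_normal_density :
  0 < gamma_mass 2^-1 /\
  forall g : R -> \bar R, measurable_fun setT g -> (forall x, (0 <= g x)%E) ->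
  (\int[std]_x ((half_pow 1 x)%:E * g (x ^+ 2)%R) =
   (1 / 2 / gamma_mass 2^-1)%:E * \int[mu]_t (g t * (gamma_wt 2^-1 t)%:E))%E.
Proof.
have [k k0 kE] := @half_normal_sqr R.
have I0 : (0 <= \int[mu]_t (gamma_wt 2^-1 t)%:E)%E.
  by apply: integral_ge0 => t _; rewrite lee_fin gamma_wt_ge0.
have kI : (k * \int[mu]_t (gamma_wt 2^-1 t)%:E = (1 / 2)%:E)%E.
  have : (\int[std]_x cst 1%E x = 1)%E.
    rewrite integral_cst// mul1e.
    exact: (@probability_setT _ _ _ (std : probability (measurableTypeR R) R)).
  rewrite (normal_even (cst 1%E))// (kE (cst 1%E))//.
  under eq_integral do rewrite mul1e.
  move=> kI; rewrite -[RHS]mule1 -[in RHS]kI muleA -EFinM.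
  by rewrite divfK ?mul1e// pnatr_eq0.
have h2 : (0 : R) < 1 / 2 by rewrite divr_gt0.
have [s s0 [Is ks]] := mule_eq_pos _ _ _ k0 I0 h2 kI.
have : (\int[mu]_t (gamma_wt 2^-1 t)%:E < +oo)%E by rewrite Is ltry.
move=> /integral_gamma_wt_fin; rewrite Is => -[sE]; rewrite /gamma_mass -sE;
  split=> //.
by move=> g mg g0; rewrite kE// ks.
Qed.

End constants.

(** * Tails of the norm, of linear forms and of their ratio *)

Section laws.
Context {R : realType} {d : measure_display} {Omega : measurableType d}.
Variables (P : probability Omega R) (n : nat) (xi : 'I_n -> {RV P >-> R}).
Hypothesis hxi : std_gaussian xi.
Local Notation mu := (@lebesgue_measure R).
Local Notation std := (normal_prob (0 : R) 1).
Local Notation prefix_sqnorm := (prefix_sqnorm P n xi).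
Local Notation prefix_dot := (prefix_dot P n xi).

Lemma prefix_sqnorm_density k : (k < n)%N ->
  0 < gamma_mass (k.+1%:R / 2 : R) /\
  forall g : R -> \bar R, measurable_fun setT g -> (forall x, (0 <= g x)%E) ->
  (\int[P]_w g (prefix_sqnorm k.+1 w) =
   (gamma_mass (k.+1%:R / 2))^-1%:E *
   \int[mu]_t (g t * (gamma_wt (k.+1%:R / 2) t)%:E))%E.
Proof.
move=> kn; have [C C0 CE] := prefix_sqnorm_law P n xi hxi k kn.
have I0 : (0 <= \int[mu]_t (gamma_wt (k.+1%:R / 2) t)%:E :> \bar R)%E.
  by apply: integral_ge0 => t _; rewrite lee_fin gamma_wt_ge0.
have CI : (C * \int[mu]_t (gamma_wt (k.+1%:R / 2) t)%:E = 1%:E)%E.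
  have : (\int[P]_w cst 1%E w = 1)%E.
    by rewrite integral_cst// mul1e; exact: probability_setT.
  rewrite (CE (cst 1%E))//.
  by under eq_integral do rewrite mul1e.
have [s s0 [Is Cs]] := mule_eq_pos _ _ _ C0 I0 ltr01 CI.
have : (\int[mu]_t (gamma_wt (k.+1%:R / 2) t)%:E < +oo :> \bar R)%E
  by rewrite Is ltry.
move=> /integral_gamma_wt_fin; rewrite Is => -[sE]; rewrite /gamma_mass -sE;
  split=> //.
by move=> g mg g0; rewrite CE// Cs div1r.
Qed.

Lemma prob_indicator (A : Omega -> bool) : measurable [set w | A w] ->
  (P [set w | A w] = \int[P]_w ((A w)%:R : R)%:E)%E.
Proof.
move=> mA; rewrite -[in LHS](setIT [set w | A w]) -integral_indic//.
apply: eq_integral => w _; rewrite indicE; congr ((nat_of_bool _)%:R%:E).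
by apply/idP/idP; rewrite inE.
Qed.

Lemma prefix_sqnorm_tail k (t : R) : (k < n)%N -> 0 <= t ->
  P [set w | t < prefix_sqnorm k.+1 w] = (Gbar k.+1%:R t)%:E.
Proof.
move=> kn t0; have [c0 cE] := prefix_sqnorm_density k kn.
have mV := measurable_prefix_sqnorm P n xi k.+1.
have mA : measurable [set w | t < prefix_sqnorm k.+1 w].
  by apply: measurable_lt_set; solve_measurable.
rewrite /Gbar -/(gamma_mass _); apply: mule_fine; first by rewrite invr_gt0.
  exact: fin_num_measure.
rewrite prob_indicator//.
rewrite (cE (fun v => ((t < v)%R%:R)%:E))//; last by solve_measurable.
congr (_ * _)%E.
rewrite -integral_itv_obnd_cbnd; last by apply: measurable_funTS;
  solve_measurable.
rewrite [RHS]integral_mkcond; apply: eq_integral => u _.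
rewrite patchE -EFinM /gamma_wt /half_pow; case: (ltP t u) => tu.
  by rewrite mem_set ?mul1r ?(le_lt_trans t0 tu)//= in_itv/= tu.
by rewrite memNset ?mul0r//= in_itv/= andbT ltNge tu.
Qed.

(** For a unit vector the factor in [joint_law] is 1 or -1, and the Gaussian law
    is symmetric. *)
Lemma prefix_dot_law a k :
  (k < n)%N -> \sum_(j < n | (j < k.+1)%N) a j ^+ 2 = 1 ->
  forall F : R -> R -> \bar R,
  measurable_fun setT (fun z : R * R => F z.1 z.2) ->
  (forall x y, (0 <= F x y)%E) ->
  (\int[P]_w F (prefix_dot a k.+1 w) (prefix_sqnorm k.+1 w) =
   \int[P]_w \int[std]_x F x (x ^+ 2 + prefix_sqnorm k w)%R)%E.
Proof.
move=> kn a1 F mF F0; have [r rE rlaw] := joint_law P n xi hxi a k kn.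
rewrite (rlaw F mF F0).
move: rE; rewrite a1 => /eqP; rewrite sqrf_eq1 => /orP[] /eqP ->.
  by apply: eq_integral => w _; apply: eq_integral => x _; rewrite mul1r.
apply: eq_integral => w _.
rewrite -[RHS]ge0_integral_normalN//; last by solve_measurable.
by apply: eq_integral => x _; rewrite mulN1r sqrrN.
Qed.

Lemma prefix_dot_tail a k (t : R) : (k < n)%N ->
  \sum_(j < n | (j < k.+1)%N) a j ^+ 2 = 1 ->
  P [set w | t < prefix_dot a k.+1 w] = (Phibar t)%:E.
Proof.
move=> kn a1.
have mU := measurable_prefix_dot P n xi a k.+1.
have mA : measurable [set w | t < prefix_dot a k.+1 w].
  by apply: measurable_lt_set; solve_measurable.
rewrite /Phibar; apply: mule_fine;
  first by rewrite powR_gt0// mulr_gt0// pi_gt0.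
  exact: fin_num_measure.
rewrite prob_indicator//.
rewrite (prefix_dot_law a k kn a1 (fun u _ => ((t < u)%R%:R)%:E))//;
  last by solve_measurable.
transitivity (\int[std]_x ((t < x)%R%:R : R)%:E)%E.
  transitivity ((\int[std]_x ((t < x)%R%:R : R)%:E) * P setT)%E.
    exact: integral_cst.
  by rewrite probability_setT mule1.
rewrite ge0_integral_normal//; last by solve_measurable.
rewrite -ge0_integralZl//; last 2 first.
- by apply: measurable_funTS; solve_measurable.
- by rewrite lee_fin powR_ge0.
rewrite -integral_itv_obnd_cbnd; last by apply: measurable_funTS;
  solve_measurable.
rewrite [RHS]integral_mkcond; apply: eq_integral => x _.
rewrite patchE -EFinM; case: (ltP t x) => tx; last first.
  by rewrite memNset ?mul0r//= in_itv/= andbT ltNge tx.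
rewrite mem_set ?mul1r//= ?in_itv/= ?tx//.
rewrite std_pdfE -EFinM; congr (_ * expR _)%:E; last by rewrite mulNr.
rewrite /normal_peak expr1n mul1r -mulr_natl powRN; congr (_^-1).
by rewrite -powR12_sqrt ?div1r// mulr_ge0// pi_ge0.
Qed.

End laws.

Section ratio.
Context {R : realType} {d : measure_display} {Omega : measurableType d}.
Variables (P : probability Omega R) (n : nat) (xi : 'I_n -> {RV P >-> R}).
Hypothesis hxi : std_gaussian xi.
Local Notation mu := (@lebesgue_measure R).
Local Notation std := (normal_prob (0 : R) 1).
Local Notation prefix_sqnorm := (prefix_sqnorm P n xi).
Local Notation prefix_dot := (prefix_dot P n xi).

Lemma integral_gamma_wt k : (k < n)%N ->
  (\int[mu]_t (gamma_wt (k.+1%:R / 2) t)%:E =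
    (gamma_mass (k.+1%:R / 2) : R)%:E)%E.
Proof.
move=> kn; have [c0 cE] := prefix_sqnorm_density P n xi hxi k kn.
have : (\int[P]_w cst 1%E w = 1)%E.
  by rewrite integral_cst// mul1e; exact: probability_setT.
rewrite (cE (cst 1%E))//; under eq_integral do rewrite mul1e.
set I := (\int[mu]_t _)%E => cI.
transitivity ((gamma_mass (k.+1%:R / 2))%:E *
  ((gamma_mass (k.+1%:R / 2))^-1%:E * I))%E.
  by rewrite muleA -EFinM divff ?mul1e// gt_eqF.
by rewrite cI mule1.
Qed.

(** With the linear form written as [W] and the squared norm as W ^ 2 + T, the
    event is W > 0 and s ^ 2 (p + T) < p for p = W ^ 2. Both [p] and [T] have
    gamma laws, and in the coordinates of [beta_gamma] the event reads
    s ^ 2 < t, so the sum p + T integrates out and the beta tail remains. *)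
Lemma ratio_tail a k (s : R) : (0 < k < n)%N ->
  \sum_(j < n | (j < k.+1)%N) a j ^+ 2 = 1 -> 0 <= s ->
  P [set w | (0 < prefix_dot a k.+1 w) &&
    (s ^+ 2 * prefix_sqnorm k.+1 w < prefix_dot a k.+1 w ^+ 2)]
  = (1 / 2 * Bbar (1 / 2) ((k.+1%:R - 1) / 2) (s ^+ 2))%:E.
Proof.
move=> /andP[k0 kn] a1 s0.
have mU := measurable_prefix_dot P n xi a k.+1.
have mV := measurable_prefix_sqnorm P n xi k.+1.
have mVk := measurable_prefix_sqnorm P n xi k.
have mA : measurable [set w | (0 < prefix_dot a k.+1 w) &&
    (s ^+ 2 * prefix_sqnorm k.+1 w < prefix_dot a k.+1 w ^+ 2)].
  rewrite (_ : [set w | _] = [set w | 0 < prefix_dot a k.+1 w] `&`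
    [set w | s ^+ 2 * prefix_sqnorm k.+1 w < prefix_dot a k.+1 w ^+ 2]);
      last first.
    by apply/seteqP; split => w /= => [/andP[]|[-> ->]].
  by apply: measurableI; apply: measurable_lt_set; solve_measurable.
have hE : (k.+1%:R - 1) / 2 = k%:R / 2 :> R by rewrite -natr1 addrK.
have hS : 1 / 2 + k%:R / 2 = k.+1%:R / 2 :> R by rewrite -natr1; ring.
have h2 : 1 / 2 = 2^-1 :> R by rewrite div1r.
have [h0 hD] := @half_normal_density R.
have [|q0 qD] := prefix_sqnorm_density P n xi hxi k.-1;
  first by rewrite prednK// ltnW.
rewrite prednK// in q0 qD.
have [n0 _] := prefix_sqnorm_density P n xi hxi k kn.
have nI := integral_gamma_wt k kn.
have GE x : (0 < gamma_mass x) = (0 < Gamma x :> R).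
  by rewrite /gamma_mass pmulr_rgt0// powR_gt0.
have Gh : 0 < Gamma (2^-1 : R) by rewrite -GE.
have Gk : 0 < Gamma (k%:R / 2 : R) by rewrite -GE.
have Gn : 0 < Gamma (k.+1%:R / 2 : R) by rewrite -GE.
pose b (t : R) : R := half_pow 2^-1 t * half_pow (k%:R / 2) (1 - t).
have b0 t : 0 <= b t by rewrite mulr_ge0 ?half_pow_ge0.
have mb : measurable_fun setT b by rewrite /b; solve_measurable.
have key : (P [set w | (0 < prefix_dot a k.+1 w)%R &&
      (s ^+ 2 * prefix_sqnorm k.+1 w < prefix_dot a k.+1 w ^+ 2)%R] =
    (1 / 2 * (gamma_mass (k.+1%:R / 2) / (gamma_mass 2^-1 *
      gamma_mass (k%:R / 2))))%:E *
    \int[mu]_t ((s ^+ 2 < t)%R%:R * b t)%R%:E)%E.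
  rewrite prob_indicator//.
  transitivity (\int[P]_w ((0 < prefix_dot a k.+1 w)%R%:R *
     (s ^+ 2 * prefix_sqnorm k.+1 w < prefix_dot a k.+1 w ^+ 2)%R%:R)%R%:E)%E.
    by apply: eq_integral => w _; rewrite -mulnb natrM.
  rewrite (prefix_dot_law P n xi hxi a k kn a1
    (fun u v => ((0 < u)%R%:R * (s ^+ 2 * v < u ^+ 2)%R%:R)%R%:E))//;
      last by solve_measurable.
  pose G v := (\int[mu]_p (((s ^+ 2 * (p + v) < p)%R%:R)%:E *
    (gamma_wt 2^-1 p)%:E))%E.
  have G0 v : (0 <= G v)%E.
    by apply: integral_ge0 => p _; rewrite mule_ge0// lee_fin gamma_wt_ge0.
  have mG : measurable_fun setT G.
    refine (@measurable_fun_integral _ _ R (measurableTypeR R) R mu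
      (fun v p : R => ((s ^+ 2 * (p + v) < p)%R%:R)%:E *
        (gamma_wt 2^-1 p)%:E)%E _ _).
      by solve_measurable.
    by move=> v p; rewrite mule_ge0// lee_fin gamma_wt_ge0.
  have h20 : (0 <= (1 / 2 / gamma_mass 2^-1 : R)%:E)%E.
    by rewrite lee_fin; apply: divr_ge0 (ltW h0); rewrite h2 invr_ge0.
  transitivity (\int[P]_w ((1 / 2 / gamma_mass 2^-1)%:E *
    G (prefix_sqnorm k w)))%E.
    apply: eq_integral => w _.
    rewrite -(hD (fun p => ((s ^+ 2 *
      (p + prefix_sqnorm k w) < p)%R%:R)%:E))//; last by solve_measurable.
    by apply: eq_integral => x _; rewrite half_pow1E -EFinM.
  rewrite ge0_integralZl//; last by apply: (measurableT_comp mG).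
  rewrite qD//.
  pose F (p t : R) : \bar R := ((s ^+ 2 * t < p)%R%:R)%:E.
  have mF : measurable_fun setT (fun z : R * R => F z.1 z.2) by rewrite /F;
    solve_measurable.
  have F0 p t : (0 <= F p t)%E by rewrite lee_fin.
  have -> : (\int[mu]_t (G t * (gamma_wt (k%:R / 2) t)%:E) =
      \int[mu]_p \int[mu]_q (F p (p + q)%R * (gamma_wt 2^-1 p *
        gamma_wt (k%:R / 2) q)%:E))%E.
    rewrite lebesgue_swap; last 2 first.
    - by solve_measurable.
    - by move=> p q; rewrite mule_ge0// lee_fin mulr_ge0 ?gamma_wt_ge0.
    apply: eq_integral => q _; rewrite -ge0_integralZr//; last 3 first.
    - by solve_measurable.
    - by move=> p _; rewrite mule_ge0// lee_fin gamma_wt_ge0.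
    - by rewrite lee_fin gamma_wt_ge0.
    by apply: eq_integral => p _; rewrite -muleA -EFinM.
  rewrite beta_gamma//.
  transitivity ((1 / 2 / gamma_mass 2^-1)%:E * ((gamma_mass (k%:R / 2))^-1%:E *
    ((\int[mu]_t ((s ^+ 2 < t)%R%:R * b t)%R%:E) *
      (gamma_mass (k.+1%:R / 2))%:E)))%E; last first.
    rewrite (muleC (\int[mu]_t _)%E) !muleA -!EFinM; congr (_%:E * _)%E.
    move: (gamma_mass 2^-1) (gamma_mass (k%:R / 2)) h0 q0 => x y x0 y0.
    by field; rewrite (gt_eqF x0) (gt_eqF y0).
  congr (_ * (_ * _))%E.
  rewrite -nI -ge0_integralZl//; last 3 first.
  - by solve_measurable.
  - by move=> t _; rewrite lee_fin gamma_wt_ge0.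
  - by apply: integral_ge0 => t _; rewrite lee_fin mulr_ge0.
  apply: eq_integral => t _.
  rewrite -ge0_integralZr//; last 3 first.
  - by solve_measurable.
  - by move=> u _; rewrite lee_fin mulr_ge0.
  - by rewrite lee_fin gamma_wt_ge0.
  apply: eq_integral => u _; rewrite /F -!EFinM; congr EFin.
  rewrite -[k.+1%:R / 2]hS h2 -/(b u) mulrA.
  have [t0|t0] := ltP 0 t; last
    by rewrite /gamma_wt /half_pow (ltNge 0 t) t0 !(mul0r, mulr0).
  by rewrite mulrC (mulrC t) ltr_pM2r// mulrC.
(* beyond 1 the beta weight vanishes, and so does Bbar *)
have [s1|s1] := leP (s ^+ 2) 1; last first.
  rewrite key integral0_eq ?mule0.
    by rewrite /Bbar leNgt s1/= mulr0.
  move=> t _; rewrite /b /half_pow subr_gt0.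
  case: (ltP (s ^+ 2) t) => st; last by rewrite mul0r.
  by rewrite (ltNge t) (ltW (lt_trans s1 st))/= !mulr0.
rewrite /Bbar s1 mulrA hE hS; apply: mule_fine; last 2 first.
- by rewrite fin_num_measure.
- rewrite key; congr (_%:E * _)%E.
    rewrite /gamma_mass h2; congr (_ * _).
    have -> : 2 `^ (k.+1%:R / 2) = 2 `^ 2^-1 * 2 `^ (k%:R / 2) :> R.
      rewrite -powRD; last by apply/implyP => _; rewrite pnatr_eq0.
      by rewrite -hS h2.
    move: (Gamma 2^-1) (Gamma (k%:R / 2)) Gh Gk => x y x0 y0.
    field; rewrite (gt_eqF x0) (gt_eqF y0).
    by rewrite (gt_eqF (powR_gt0 _ _))// (gt_eqF (powR_gt0 _ _)).
  rewrite [RHS]integral_itv_bndoo; last by apply: measurable_funTS;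
    solve_measurable.
  rewrite [RHS]integral_mkcond; apply: eq_integral => t _.
  rewrite patchE /b /half_pow subr_gt0 h2.
  case: (ltP (s ^+ 2) t) => st; last first.
    by rewrite memNset ?mul0r//= in_itv/= ltNge st.
  rewrite (le_lt_trans (sqr_ge0 _) st) mul1r; case: (ltP t 1) => t1.
    by rewrite mem_set//= in_itv/= st t1.
  by rewrite mulr0 memNset//= in_itv/= st ltNge t1.
rewrite h2; apply: mulr_gt0; first by rewrite invr_gt0.
by apply: divr_gt0 Gn _; exact: mulr_gt0 Gh Gk.
Qed.

End ratio.

(** * Two linear forms exceeding a level *)

Section euclid.
Context {R : realType} {n : nat}.
Implicit Types u v x : 'rV[R]_n.

Lemma dotC u v : dot u v = dot v u.
Proof. by apply: eq_bigr => k _; rewrite mulrC. Qed.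

Lemma dotDr u v x : dot u (v + x) = dot u v + dot u x.
Proof. by rewrite -big_split; apply: eq_bigr => k _; rewrite mxE mulrDr. Qed.

Lemma dotZr a u v : dot u (a *: v) = a * dot u v.
Proof.
by rewrite /dot mulr_sumr; apply: eq_bigr => k _; rewrite mxE mulrCA.
Qed.

Lemma dotDl u v x : dot (u + v) x = dot u x + dot v x.
Proof. by rewrite dotC dotDr !(dotC x). Qed.

Lemma dotZl a u v : dot (a *: u) v = a * dot u v.
Proof. by rewrite dotC dotZr dotC. Qed.

Lemma dot_ge0 u : 0 <= dot u u.
Proof. by apply: sumr_ge0 => k _; rewrite -expr2 sqr_ge0. Qed.

Lemma dot_enorm1 u : enorm u = 1 -> dot u u = 1.
Proof.
by move=> u1; rewrite -(sqr_sqrtr (dot_ge0 u)) -/(enorm u) u1 expr1n.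
Qed.

(** The squared distance from [x] to the plane of [u] and [v] is nonnegative;
    scaling by 1 - r ^ 2 clears the denominators of the projection. *)
Lemma gram3_ge0 u v x (r p q : R) : dot u u = 1 -> dot v v = 1 ->
  dot u v = r -> dot u x = p -> dot v x = q -> r ^+ 2 < 1 ->
  p ^+ 2 - 2 * r * p * q + q ^+ 2 <= (1 - r ^+ 2) * dot x x.
Proof.
move=> uu vv uv ux vx r1.
have D0 : 0 < 1 - r ^+ 2 by rewrite subr_gt0.
have := dot_ge0 ((1 - r ^+ 2) *: x + (r * q - p) *: u + (r * p - q) *: v).
rewrite !(dotDl, dotDr, dotZl, dotZr) uu vv (dotC v u) uv (dotC x u) (dotC x v)
  ux vx.
set X := dot x x => H.
rewrite -subr_ge0 -(pmulr_rge0 _ D0); apply: le_trans H _.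
rewrite le_eqVlt; apply/orP; left; apply/eqP; ring.
Qed.

(** The squared distance from [x] to the line of [u] is nonnegative. *)
Lemma cauchy_unit u x : dot u u = 1 -> dot u x ^+ 2 <= dot x x.
Proof.
move=> uu; have := dot_ge0 (x + (- dot u x) *: u).
rewrite !(dotDl, dotDr, dotZl, dotZr) uu (dotC x u) => H.
by rewrite -subr_ge0; apply: le_trans H _; rewrite le_eqVlt; apply/orP; left;
  apply/eqP; ring.
Qed.
End euclid.

(** If si / sj <= r then already p ^ 2 <= X is enough. Otherwise the quadratic
    form in the last hypothesis increases along both axes from the corner where
    si p = sj q = c, so its value at (p, q) exceeds its value at the corner,
    which is (c / si) ^ 2 (1 - r ^ 2 + (si / sj - r) ^ 2). *)
Lemma critical_ineq (R : realFieldType) (si sj r p q c X : R) :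
  0 < si -> 0 < sj -> r ^+ 2 < 1 -> r <= sj / si -> 0 <= c ->
  c < si * p -> c < sj * q -> p ^+ 2 <= X ->
  p ^+ 2 - 2 * r * p * q + q ^+ 2 <= (1 - r ^+ 2) * X ->
  c ^+ 2 < si ^+ 2 / (1 + Num.max (si / sj - r) 0 ^+ 2 / (1 - r ^+ 2)) * X.
Proof.
move=> si0 sj0 r1 rji c0 cp cq pX pqX.
have D0 : 0 < 1 - r ^+ 2 by rewrite subr_gt0.
have [er|re] := leP (si / sj - r) 0.
  rewrite expr0n/= mul0r addr0 divr1.
  apply: lt_le_trans (ler_wpM2l (sqr_ge0 si) pX).
  by rewrite -exprMn ltr_pXn2r// nnegrE// ltW// (le_lt_trans c0).
set e := si / sj in re *.
have e0 : 0 < e by rewrite divr_gt0.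
have -> : si ^+ 2 / (1 + (e - r) ^+ 2 / (1 - r ^+ 2)) * X =
    si ^+ 2 * ((1 - r ^+ 2) * X) / (1 - r ^+ 2 + (e - r) ^+ 2).
  by field; rewrite (gt_eqF D0) gt_eqF// ltr_wpDr ?sqr_ge0.
rewrite ltr_pdivlMr; last by rewrite ltr_wpDr ?sqr_ge0.
apply: lt_le_trans (ler_wpM2l (sqr_ge0 si) pqX).
(* coordinates relative to the corner; the difference is a sum of squares and
   of products of nonnegative factors *)
have [x x0 xE] : exists2 x, 0 < x & si * p = c + x.
  by exists (si * p - c); [rewrite subr_gt0|ring].
have [y y0 yE] : exists2 y, 0 < y & sj * q = c + y.
  by exists (sj * q - c); [rewrite subr_gt0|ring].
have qE : si * q = e * (c + y) by rewrite -yE mulrA divfK// gt_eqF.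
have -> : si ^+ 2 * (p ^+ 2 - 2 * r * p * q + q ^+ 2) =
    (c + x) ^+ 2 - 2 * r * (c + x) * (e * (c + y)) + (e * (c + y)) ^+ 2.
  by rewrite -xE -qE; ring.
have re1 : 0 <= 1 - r * e.
  by rewrite subr_ge0 -ler_pdivlMr// mul1r invf_div.
rewrite -subr_gt0.
have -> : (c + x) ^+ 2 - 2 * r * (c + x) * (e * (c + y)) + (e * (c + y)) ^+ 2
    - c ^+ 2 * (1 - r ^+ 2 + (e - r) ^+ 2) =
  (x - r * e * y) ^+ 2 + (2 * c * x * (1 - r * e) + 2 * c * y * e * (e - r)) +
  e ^+ 2 * y ^+ 2 * (1 - r ^+ 2) by ring.
rewrite ltr_wpDl//; last first.
  by apply: mulr_gt0 => //; apply: mulr_gt0; exact: exprn_gt0.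
apply: addr_ge0; first exact: sqr_ge0.
by apply: addr_ge0; rewrite ?mulr_ge0 ?(ltW re) ?(ltW x0) ?(ltW y0) ?(ltW e0)
  ?(ltW si0) ?invr_ge0 ?(ltW sj0).
Qed.

Section critical.
Context {R : realType} {K n : nat}.
Variables (sigma : 'I_K -> R) (phi : 'I_K -> 'rV[R]_n).
Hypotheses (hphi : forall i, enorm (phi i) = 1)
  (hrho : forall i j, i != j -> `|rho phi i j| < 1)
  (hsigma : forall i, 0 < sigma i).
Local Notation bc := (b_cri sigma phi).

Lemma rho_sqr_lt1 i j : i != j -> rho phi i j ^+ 2 < 1.
Proof.
by move=> /hrho; rewrite -{2}(expr1n _ 2) -real_normK ?num_real//
  ltr_pXn2r ?nnegrE.
Qed.

Lemma h_ge0 i j : i != j -> 0 <= h sigma phi i j.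
Proof.
by move=> ij; rewrite divr_ge0 ?sqr_ge0// subr_ge0 ltW// rho_sqr_lt1.
Qed.

Lemma b_cri_ge0 : 0 <= bc. Proof. exact: sqrtr_ge0. Qed.

Lemma b_cri_ge i j : i != j -> sigma i ^+ 2 / (1 + h sigma phi i j) <= bc ^+ 2.
Proof.
move=> ij; rewrite sqr_sqrtr; last exact: bigmax_ge_id.
exact: (le_bigmax_cond _ (j := (i, j))
  (fun p : 'I_K * 'I_K => sigma p.1 ^+ 2 / (1 + h sigma phi p.1 p.2))).
Qed.

Lemma b_cri_gt0 : (2 <= K)%N -> 0 < bc.
Proof.
move=> K2; pose i0 := Ordinal (ltnW K2); pose i1 := Ordinal K2.
have i01 : i0 != i1 by [].
rewrite lt_neqAle b_cri_ge0 andbT eq_sym -sqrf_eq0 gt_eqF//.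
apply: lt_le_trans (b_cri_ge i0 i1 i01).
by rewrite divr_gt0 ?exprn_gt0// ltr_wpDr// h_ge0.
Qed.

(** Two of the linear forms can both exceed [c] only at points of norm above
    c / b_cri. [critical_ineq] asks for rho <= sigma j / sigma i; since
    rho < 1, at most one of the two ratios lies below rho, so the inequality
    holds for the pair in one of its orders. *)
Lemma b_cri_norm_lt (i j : 'I_K) x c : i != j -> 0 <= c ->
  c < Xval sigma phi x i -> c < Xval sigma phi x j ->
  c ^+ 2 < bc ^+ 2 * dot x x.
Proof.
wlog ij_le : i j / rho phi i j <= sigma j / sigma i => [wlog_ij ij c0 ci cj|].
  have [ij'|ij'] := leP (rho phi i j) (sigma j / sigma i).
    exact: (wlog_ij i j).
  apply: (wlog_ij j i) => //; last by rewrite eq_sym.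
  rewrite /rho dotC -/(rho phi i j).
  have r1 : rho phi i j < 1 by rewrite (le_lt_trans (ler_norm _))// hrho.
  rewrite ler_pdivlMr//; apply: ltW; apply: lt_trans (_ : sigma j < sigma i).
    by rewrite gtr_pMl.
  by have := lt_trans ij' r1; rewrite ltr_pdivrMr// mul1r.
move=> ij c0 ci cj.
have ui := dot_enorm1 _ (hphi i); have uj := dot_enorm1 _ (hphi j).
have r1 := rho_sqr_lt1 i j ij.
apply: lt_le_trans (ler_wpM2r (dot_ge0 x) (b_cri_ge i j ij)).
apply: (critical_ineq _ _ _ _ (dot (phi i) x) (dot (phi j) x)) => //.
- exact: cauchy_unit.
- exact: (gram3_ge0 (phi i) (phi j) x).
Qed.
End critical.

(** * Probability of a union of nearly disjoint events *)

Section union_approx.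
Context {R : realType} {d : measure_display} {Omega : measurableType d}.
Variables (P : probability Omega R) (K : nat) (E : 'I_K -> set Omega)
  (B : set Omega) (Q : pred 'I_K).
Hypotheses (mE : forall i, measurable (E i)) (mB : measurable B).
Hypothesis EE : forall i j, i != j -> E i `&` E j `<=` B.
Hypothesis EQ : forall i, ~~ Q i -> E i `<=` B.

Lemma bigsetU_exists (F : 'I_K -> set Omega) (S : pred 'I_K) :
  \big[setU/set0]_(i < K | S i) F i = [set w | exists2 i, S i & F i w].
Proof.
apply/seteqP; split => w /=.
  by elim/big_ind: _ => // [X Y HX HY [/HX|/HY]//|i Si Fi]; exists i.
by move=> [i Si Fi]; rewrite (bigD1 i)//=; left.
Qed.

Lemma bigsetU_exists_measurable (F : 'I_K -> set Omega) (S : pred 'I_K) :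
  (forall i, measurable (F i)) ->
  measurable [set w | exists2 i, S i & F i w].
Proof. by move=> mF; rewrite -bigsetU_exists; exact: bigsetU_measurable. Qed.

(** Outside [B] the events are pairwise disjoint, and those not selected by [Q]
    do not occur. So the union and the selected sum both differ little from
    the probability of the disjoint union of the sets [E i `\` B]: the union by
    at most P B, and the sum by at most P B per term. With an empty [B] the
    estimate is an equality. *)
Lemma union_approx :
  `|fine (P [set w | exists i, E i w]) - \sum_(i < K | Q i) fine (P (E i))|
  <= K.+1%:R * fine (P B).
Proof.
pose p X := fine (P X).
have pP X : measurable X -> P X = (p X)%:E.
  by move=> mX; rewrite /p fineK// fin_num_measure.
have pW X Y : measurable X -> measurable Y -> X `<=` Y -> p X <= p Y.
  by move=> mX mY XY; rewrite fine_le ?fin_num_measure// le_measure ?inE.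
have pU X Y : measurable X -> measurable Y -> p (X `|` Y) <= p X + p Y.
  move=> mX mY; rewrite -lee_fin EFinD -!pP//; last exact: measurableU.
  exact: measureU2.
(* pairwise disjoint, unlike the E i *)
pose F i := E i `\` B.
have mF i : measurable (F i) by exact: measurableD.
pose U := [set w | exists2 i, Q i & F i w].
have mU : measurable U by exact: bigsetU_exists_measurable.
pose A := [set w | exists i, E i w].
have mA : measurable A.
  rewrite (_ : A = [set w | exists2 i, xpredT i & E i w]); last first.
    by apply/seteqP; split => w [i]; exists i.
  exact: bigsetU_exists_measurable.
have UE : p U = \sum_(i < K | Q i) p (F i).
  apply: EFin_inj; rewrite -pP// /U -bigsetU_exists measure_bigsetU_ord_cond//;
    last first.
    apply/trivIsetP => i j _ _ ij; rewrite -subset0 => w [[Ei nB] [Ej _]].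
    exact: nB (EE _ _ ij _ (conj Ei Ej)).
  by rewrite -sumEFin; apply: eq_bigr => i _; exact: pP.
have UA : p U <= p A by apply: pW => // w [i _ [Ei _]]; exists i.
have AU : p A <= p U + p B.
  apply: le_trans (pU _ _ mU mB); apply: pW => //; first exact: measurableU.
  move=> w [i Ei]; have [wB|wB] := pselect (B w); first by right.
  left; exists i => //; apply: contrapT => /negP Qi.
  by apply: wB; exact: EQ Qi _ Ei.
have US : p U <= \sum_(i < K | Q i) p (E i).
  by rewrite UE; apply: ler_sum => i _; apply: pW => // w [].
have pB0 : 0 <= p B by rewrite fine_ge0.
have SU : \sum_(i < K | Q i) p (E i) <= p U + K%:R * p B.
  apply: (@le_trans _ _ (\sum_(i < K | Q i) (p (F i) + p B))).
    apply: ler_sum => i _; apply: le_trans (pU _ _ (mF i) mB).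
    apply: pW => //; first exact: measurableU.
    by move=> w Ei; have [wB|wB] := pselect (B w); [right|left].
  rewrite big_split/= -UE lerD2l sumr_const -[leLHS]mulr_natl ler_wpM2r//.
  by rewrite ler_nat (leq_trans (max_card _))// card_ord.
rewrite -/(p _) -/(p B) -natr1 mulrDl mul1r ler_norml.
have KB : 0 <= K%:R * p B by rewrite mulr_ge0.
apply/andP; split; lra.
Qed.

End union_approx.

(** * Tails of the maxima *)

Lemma lt_maxI (R : realType) (K : nat) (hK : (0 < K)%N) (F : 'I_K -> R)
    (c : R) :
  c < maxI hK F <-> exists i, c < F i.
Proof.
split=> [/bigmax_gtP[cF|[i _ cF]]|[i cF]];
  [by exists (Ordinal hK)|by exists i|].
by apply/bigmax_gtP; right; exists i.
Qed.

(** In dimension 1 unit vectors have inner product 1 or -1. *)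
Lemma dim_gt1 (R : realType) (K n : nat) (phi : 'I_K -> 'rV[R]_n) :
  (2 <= K)%N -> (forall i, enorm (phi i) = 1) ->
  (forall i j, i != j -> `|rho phi i j| < 1) -> (1 < n)%N.
Proof.
move=> K2 hphi hrho.
pose i0 := Ordinal (ltnW K2); pose i1 := Ordinal K2.
have := hrho i0 i1 isT; have := dot_enorm1 _ (hphi i0);
  have := dot_enorm1 _ (hphi i1).
case: n phi {hphi hrho} => [|[|//]] phi; rewrite /rho /dot.
  by rewrite big_ord0 => /eqP; rewrite eq_sym oner_eq0.
rewrite !big_ord1 => u1 v1 lt1.
have : `|phi i0 0 0 * phi i1 0 0| ^+ 2 < 1 by rewrite exprn_ilt1.
by rewrite real_normK ?num_real// expr2 mulrACA u1 v1 mulr1 ltxx.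
Qed.

Section tails.
Context {R : realType} {d : measure_display} {Omega : measurableType d}.
Variables (P : probability Omega R) (K n : nat).
Variables (phi : 'I_K -> 'rV[R]_n) (sigma : 'I_K -> R)
  (xi : 'I_n -> {RV P >-> R}).
Hypotheses (hK : (2 <= K)%N) (hphi : forall i, enorm (phi i) = 1)
  (hrho : forall i j, i != j -> `|rho phi i j| < 1)
  (hsigma : forall i, 0 < sigma i) (hxi : std_gaussian xi) (n1 : (1 < n)%N).
Local Notation bc := (b_cri sigma phi).
Local Notation prefix_sqnorm := (prefix_sqnorm P n xi).
Local Notation coef i := (fun j : 'I_n => phi i 0 j).

Lemma predn_ltn : (n.-1 < n)%N. Proof. by rewrite ltn_predL ltnW. Qed.
Let nE : n.-1.+1 = n. Proof. by rewrite prednK// ltnW. Qed.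

Lemma dot_vecE i w : dot (phi i) (vec xi w) = prefix_dot P n xi (coef i) n w.
Proof. by apply: eq_big => [j|j _]; rewrite ?ltn_ord// mxE. Qed.

Lemma dot_vec_vecE w : dot (vec xi w) (vec xi w) = prefix_sqnorm n w.
Proof. by apply: eq_big => [j|j _]; rewrite ?ltn_ord// !mxE expr2. Qed.

Lemma coef_unit i : \sum_(j < n | (j < n)%N) phi i 0 j ^+ 2 = 1.
Proof.
rewrite -[RHS](dot_enorm1 _ (hphi i)).
by apply: eq_big => [j|j _]; rewrite ?ltn_ord// expr2.
Qed.

Lemma measurable_Xval i :
  measurable_fun setT (fun w => Xval sigma phi (vec xi w) i).
Proof.
apply: measurable_funM => //.
rewrite (_ : (fun w => _) = prefix_dot P n xi (coef i) n);
  first exact: measurable_prefix_dot.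
by apply/funext => w; exact: dot_vecE.
Qed.

Lemma Xval_tail i (c : R) :
  P [set w | c < Xval sigma phi (vec xi w) i] = (Phibar (c / sigma i))%:E.
Proof.
have := prefix_dot_tail P n xi hxi (coef i) n.-1 (c / sigma i) predn_ltn.
rewrite nE => /(_ (coef_unit i)) <-; congr (P _).
by apply/seteqP; split => w /=; rewrite /Xval dot_vecE ltr_pdivrMr// mulrC.
Qed.

(** [union_approx] with [B] the event that the norm exceeds c / b_cri. The two
    index sets of interest, all indices and those with sigma i > b_cri, both
    satisfy the condition on [Q]: if sigma i <= b_cri then X_i > c already puts
    the norm above c / b_cri. *)
Lemma Xmax_tail (Q : pred 'I_K) (c : R) :
  (forall i, ~~ Q i -> sigma i <= bc) -> 0 <= c ->
  `|fine (P [set w | c < Xmax sigma phi (ltnW hK) (vec xi w)])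
    - \sum_(i < K | Q i) Phibar (c / sigma i)|
  <= K.+1%:R * Gbar n%:R (c ^+ 2 / bc ^+ 2).
Proof.
move=> hQ c0.
have bc0 : 0 < bc by exact: b_cri_gt0.
have := prefix_sqnorm_tail P n xi hxi n.-1 (c ^+ 2 / bc ^+ 2) predn_ltn.
rewrite nE divr_ge0 ?sqr_ge0// => /(_ isT) PB.
rewrite -[Gbar _ _]/(fine (Gbar _ _)%:E) -PB.
under eq_bigr do rewrite -[Phibar _]/(fine (Phibar _)%:E) -Xval_tail.
rewrite (_ : [set w | c < Xmax sigma phi (ltnW hK) (vec xi w)] =
    [set w | exists i, c < Xval sigma phi (vec xi w) i]); last first.
  by apply/seteqP; split => w /= /(lt_maxI _ _ (ltnW hK)).
apply: (union_approx P K (fun i => [set w | c < Xval sigma phi (vec xi w) i])).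
- by move=> i; apply: measurable_lt_set => //; exact: measurable_Xval.
- by apply: measurable_lt_set => //; exact: measurable_prefix_sqnorm.
- move=> i j ij w [/= ci cj]; rewrite ltr_pdivrMr ?exprn_gt0// mulrC.
  by rewrite -dot_vec_vecE; exact: b_cri_norm_lt ij c0 ci cj.
- move=> i /hQ sb w /= ci; rewrite ltr_pdivrMr ?exprn_gt0// mulrC.
  rewrite -dot_vec_vecE.
  have := cauchy_unit _ (vec xi w) (dot_enorm1 _ (hphi i)) => CS.
  apply: (@lt_le_trans _ _ (Xval sigma phi (vec xi w) i ^+ 2)).
    by rewrite ltr_pXn2r// nnegrE// ltW// (le_lt_trans c0).
  by rewrite /Xval exprMn ler_pM ?sqr_ge0// ler_pXn2r// nnegrE ltW.
Qed.

(** At the origin [Yval] vanishes, so an exceedance of b >= 0 happens elsewhere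
    and rescales to one of the linear form. *)
Lemma Yval_gt (b : R) i x : 0 <= b -> b < Yval sigma phi x i ->
  0 < dot x x /\ b * enorm x < Xval sigma phi x i.
Proof.
move=> b0; rewrite /Yval dotZr mulrCA -/(Xval sigma phi x i) => bY.
have x0 : 0 < enorm x.
  rewrite lt_neqAle sqrtr_ge0 andbT eq_sym; apply: contraTneq bY => ->.
  by rewrite invr0 mul0r -leNgt.
split; first by rewrite -sqrtr_gt0.
by rewrite mulrC -ltr_pdivlMl.
Qed.

Lemma Yval_event (b : R) i : 0 < b ->
  [set w | b < Yval sigma phi (vec xi w) i] =
  [set w | (0 < prefix_dot P n xi (coef i) n w) &&
    ((b / sigma i) ^+ 2 * prefix_sqnorm n w <
       prefix_dot P n xi (coef i) n w ^+ 2)].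
Proof.
move=> b0; apply/seteqP; split => w /=.
  move=> /(Yval_gt _ _ _ (ltW b0))[x0]; rewrite /Xval dot_vecE => bU.
  have bN0 : 0 <= b * enorm (vec xi w) by rewrite mulr_ge0 ?sqrtr_ge0// ltW.
  have U0 : 0 < prefix_dot P n xi (coef i) n w.
    by rewrite -(pmulr_rgt0 _ (hsigma i)) (le_lt_trans bN0).
  rewrite U0/= -dot_vec_vecE -(sqr_sqrtr (dot_ge0 _)) -/(enorm _) -exprMn.
  rewrite ltr_pXn2r// ?nnegrE ?(ltW U0)//.
    by rewrite mulrAC ltr_pdivrMr// [ltRHS]mulrC.
  by rewrite mulr_ge0 ?sqrtr_ge0// divr_ge0// ltW.
move=> /andP[U0].
have V0 : 0 < dot (vec xi w) (vec xi w).
  apply: lt_le_trans (cauchy_unit _ _ (dot_enorm1 _ (hphi i))).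
  by rewrite exprn_gt0// dot_vecE.
have N0 : 0 < enorm (vec xi w) by rewrite sqrtr_gt0.
rewrite -dot_vec_vecE -(sqr_sqrtr (dot_ge0 _)) -/(enorm _) -exprMn.
rewrite ltr_pXn2r ?nnegrE ?(ltW U0)//; last first.
  by rewrite mulr_ge0 ?sqrtr_ge0// divr_ge0// ltW.
rewrite mulrAC ltr_pdivrMr// => bU.
by rewrite /Yval dotZr dot_vecE mulrCA [ltRHS]mulrC ltr_pdivlMr// [ltRHS]mulrC.
Qed.

Lemma Yval_tail i (b : R) : 0 < b ->
  P [set w | b < Yval sigma phi (vec xi w) i] =
  (1 / 2 * Bbar (1 / 2) ((n%:R - 1) / 2) (b ^+ 2 / sigma i ^+ 2))%:E.
Proof.
move=> b0.
have np : (0 < n.-1 < n)%N by rewrite predn_ltn andbT -ltnS nE.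
have := ratio_tail P n xi hxi (coef i) n.-1 (b / sigma i) np.
rewrite nE => /(_ (coef_unit i)).
rewrite divr_ge0 ?ltW// => /(_ isT); rewrite expr_div_n => <-.
by rewrite Yval_event// expr_div_n.
Qed.

(** Rescaled by the norm, two simultaneous exceedances of [b] would contradict
    [b_cri_norm_lt], and one with sigma i <= b_cri the Cauchy-Schwarz
    inequality; so [union_approx] applies with [B] empty. *)
Lemma Ymax_tail (Q : pred 'I_K) (b : R) :
  (forall i, ~~ Q i -> sigma i <= bc) -> bc <= b ->
  P [set w | b < Ymax sigma phi (ltnW hK) (vec xi w)] =
  (\sum_(i < K | Q i)
     1 / 2 * Bbar (1 / 2) ((n%:R - 1) / 2) (b ^+ 2 / sigma i ^+ 2))%:E.
Proof.
move=> hQ bcb.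
have bc0 : 0 < bc by exact: b_cri_gt0.
have b0 : 0 < b by exact: lt_le_trans bcb.
have mY i : measurable [set w | b < Yval sigma phi (vec xi w) i].
  rewrite Yval_event//.
  rewrite (_ : [set w | _] = [set w | 0 < prefix_dot P n xi (coef i) n w] `&`
    [set w | (b / sigma i) ^+ 2 *
      prefix_sqnorm n w < prefix_dot P n xi (coef i) n w ^+ 2]); last first.
    by apply/seteqP; split => w /= => [/andP[]|[-> ->]].
  have mU := measurable_prefix_dot P n xi (coef i) n.
  have mV := measurable_prefix_sqnorm P n xi n.
  by apply: measurableI; apply: measurable_lt_set; solve_measurable.
rewrite (_ : [set w | b < Ymax sigma phi (ltnW hK) (vec xi w)] =
    [set w | exists i, b < Yval sigma phi (vec xi w) i]); last first.
  by apply/seteqP; split => w /= /(lt_maxI _ _ (ltnW hK)).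
have mA : measurable [set w | exists i, b < Yval sigma phi (vec xi w) i].
  rewrite (_ : [set w | _] =
    [set w | exists2 i, xpredT i & b < Yval sigma phi (vec xi w) i]);
    last first.
    by apply/seteqP; split => w [i]; exists i.
  exact: (bigsetU_exists_measurable K (fun i =>
    [set w | b < Yval sigma phi (vec xi w) i])).
rewrite -[LHS]fineK ?fin_num_measure//; congr EFin.
apply/eqP; rewrite -subr_eq0 -normr_le0.
have := union_approx P K (fun i =>
  [set w | b < Yval sigma phi (vec xi w) i]) set0 Q mY measurable0.
rewrite measure0 mulr0.
under eq_bigr do rewrite Yval_tail//.
apply.
- move=> i j ij w [/= bi bj].
  have [x0 {}bi] := Yval_gt _ _ _ (ltW b0) bi.
  have [_ {}bj] := Yval_gt _ _ _ (ltW b0) bj.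
  have be0 : 0 <= b * enorm (vec xi w) by rewrite mulr_ge0 ?sqrtr_ge0// ltW.
  have := b_cri_norm_lt sigma phi hphi hrho hsigma i j _ _ ij be0 bi bj.
  rewrite exprMn sqr_sqrtr ?dot_ge0// ltr_pM2r//
    ltNge ler_pXn2r ?nnegrE ?(ltW b0) ?(ltW bc0)//.
  by rewrite bcb.
- move=> i /hQ sb w /(Yval_gt _ _ _ (ltW b0))[x0 bi].
  have CS := cauchy_unit _ (vec xi w) (dot_enorm1 _ (hphi i)).
  have pN : dot (phi i) (vec xi w) <= enorm (vec xi w).
    have [p0|p0] := ltP 0 (dot (phi i) (vec xi w));
      last exact: le_trans p0 (sqrtr_ge0 _).
    by rewrite -(ler_pXn2r (n := 2)) ?nnegrE ?sqrtr_ge0 ?(ltW p0)//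
      sqr_sqrtr // dot_ge0.
  have : Xval sigma phi (vec xi w) i <= b * enorm (vec xi w).
    apply: le_trans (ler_wpM2l (ltW (hsigma i)) pN) _.
    by rewrite ler_wpM2r ?sqrtr_ge0// (le_trans sb).
  by rewrite leNgt bi.
Qed.

End tails.

Theorem theorem2p11 (R : realType) (d : measure_display)
  (Omega : measurableType d) (P : probability Omega R)
  (K n : nat) (hK : (2 <= K)%N)
  (phi : 'I_K -> 'rV[R]_n) (hphi : forall i, enorm (phi i) = 1)
  (hrho : forall i j, i != j -> `|rho phi i j| < 1)
  (sigma : 'I_K -> R) (hsigma : forall i, 0 < sigma i)
  (xi : 'I_n -> {RV P >-> R}) (hxi : std_gaussian xi) :
  let bc := b_cri sigma phi in
  let X_max (w : Omega) := Xmax sigma phi (ltnW hK) (vec xi w) in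
  let Y_max (w : Omega) := Ymax sigma phi (ltnW hK) (vec xi w) in
  [/\ forall b : R, bc <= b ->
        P [set w | b < Y_max w]
        = (\sum_(i < K)
             1 / 2 * Bbar (1 / 2) ((n%:R - 1) / 2) (b ^+ 2 / sigma i ^+ 2))%:E,
      (fun c : R => fine (P [set w | c < X_max w]) : R^o)
      = (fun c : R => \sum_(i < K) Phibar (c / sigma i) : R^o)
        +O_ (+oo_R) (fun c : R => Gbar n%:R (c ^+ 2 / bc ^+ 2) : R^o),
      forall b : R, bc <= b ->
        P [set w | b < Y_max w]
        = (\sum_(i < K | bc < sigma i)
             1 / 2 * Bbar (1 / 2) ((n%:R - 1) / 2) (b ^+ 2 / sigma i ^+ 2))%:E
    & (fun c : R => fine (P [set w | c < X_max w]) : R^o)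
      = (fun c : R => \sum_(i < K | bc < sigma i) Phibar (c / sigma i) : R^o)
        +O_ (+oo_R) (fun c : R => Gbar n%:R (c ^+ 2 / bc ^+ 2) : R^o)].
Proof.
move=> bc X_max Y_max.
have n1 : (1 < n)%N by exact: dim_gt1 hK hphi hrho.
have O_tail (Q : pred 'I_K) : (forall i, ~~ Q i -> sigma i <= bc) ->
    (fun c : R => fine (P [set w | c < X_max w]) : R^o)
    = (fun c : R => \sum_(i < K | Q i) Phibar (c / sigma i) : R^o)
      +O_ (+oo_R) (fun c : R => Gbar n%:R (c ^+ 2 / bc ^+ 2) : R^o).
  move=> hQ; apply/eqaddOP; near=> k; near=> c.
  apply: le_trans (Xmax_tail P K n phi sigma xi hK hphi hrho hsigma hxi n1 Q c
    hQ _) _.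
    by near: c; exact: nbhs_pinfty_ge.
  apply: (@le_trans _ _ (K.+1%:R * `|Gbar n%:R (c ^+ 2 / bc ^+ 2)|)).
    by rewrite ler_wpM2l// ler_norm.
  by rewrite ler_wpM2r//; near: k; exact: nbhs_pinfty_ge.
split.
- by move=> b bcb; apply: Ymax_tail.
- exact: O_tail.
- by move=> b bcb; apply: Ymax_tail => // i; rewrite -leNgt.
- by apply: O_tail => i; rewrite -leNgt.
Unshelve. all: by end_near.
Qed.
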